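(* Suppose $(X,\mathcal{A},\mu,T)$ is an ergodic probability preserving system, $(A_l)$ an asymptotically rare sequence in $\mathcal{A}$, and $(\psi_{A_l})_{l\ge1}$ a sequence of $\mathfrak{F}$-valued local observables for the $A_l$ with corresponding local processes $\Psi_{A_l}$. Assume there are measurable $\tau_l:X\to\mathbb{N}_0$ with $\mu_{A_l}(\tau_l<\varphi_{A_l})\to1$ as $l\to\infty$, while there is a compact subset $\mathfrak{K}$ of $(\mathfrak{P},d_{\mathfrak{P}})$ with $T^{\tau_l}_\ast\mu_{A_l}\in\mathfrak{K}$ for $l\ge1$. Let $(\Phi_{\mathrm{Exp}},\Psi^\ast)$ be an independent pair of iid sequences ($\Phi_{\mathrm{Exp}}$ iid standard exponential, $\Psi^\ast$ iid in $\mathfrak{F}$). Then $$(\mu(A_l)\Phi_{A_l},\Psi_{A_l})\overset{\mu}{\Longrightarrow}(\Phi_{\mathrm{Exp}},\Psi^\ast)\quad\text{iff}\quad(\mu(A_l)\Phi_{A_l},\widetilde\Psi_{A_l})\overset{\mu_{A_l}}{\Longrightarrow}(\Phi_{\mathrm{Exp}},\Psi^\ast)\qquad\text{as }l\to\infty.$$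
   Context: $(\mathfrak{F},d_{\mathfrak{F}})$ compact metric space. For $A$ with $\mu(A)>0$: $\varphi_A(x):=\inf\{n\ge1:T^nx\in A\}$, $T_Ax:=T^{\varphi_A(x)}x$, $\mu_A:=\mu(A\cap\cdot)/\mu(A)$, $\Phi_A:=(\varphi_A,\varphi_A\circ T_A,\ldots)$ viewed in $[0,\infty]^{\mathbb{N}_0}$ ($[0,\infty]$ metrized by $|e^{-s}-e^{-t}|$, product metric). Asymptotically rare: $0<\mu(A_l)\to0$. Local observable: measurable $\psi_A:A\to\mathfrak{F}$; $\Psi_A:=(\psi_A\circ T_A,\psi_A\circ T_A^2,\ldots):X\to\mathfrak{F}^{\mathbb{N}}$, $\widetilde\Psi_A:=(\psi_A,\psi_A\circ T_A,\ldots):A\to\mathfrak{F}^{\mathbb{N}_0}$. $\mathfrak{P}$: probabilities $\nu\ll\mu$, $d_{\mathfrak{P}}(\nu,\nu')=2\sup_A|\nu(A)-\nu'(A)|$. $T^\tau x:=T^{\tau(x)}x$, $T^\tau_\ast\nu:=\nu\circ(T^\tau)^{-1}$. $\overset{\nu}{\Longrightarrow}$: weak convergence of laws under $\nu$. *)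

(* Defs.v *)
From HB Require Import structures.
From mathcomp Require Import all_boot all_order all_algebra.
From mathcomp Require Import all_classical all_reals all_analysis.
Set Implicit Arguments. Unset Strict Implicit. Unset Printing Implicit Defensive.
Import Order.TTheory GRing.Theory Num.Theory.
Import numFieldNormedType.Exports.
Local Open Scope classical_set_scope.
Local Open Scope ring_scope.

Section Defs.
Context {R : realType} {d : measure_display} {X : measurableType d}.

Definition measure_preserving (mu : probability X R) (T : X -> X) :=
  measurable_fun setT T /\
  forall A, measurable A -> mu (T @^-1` A) = mu A.

Definition ergodic (mu : probability X R) (T : X -> X) :=
  forall A, measurable A -> T @^-1` A = A -> mu A = 0%E \/ mu A = 1%E.

Definition hits (T : X -> X) (A : set X) (x : X) : set nat :=
  [set n | (0 < n)%N /\ A (iter n T x)].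

Definition phiA (T : X -> X) (A : set X) (x : X) : \bar R :=
  ereal_inf [set (n%:R)%:E | n in hits T A x].

(* the same as a natural number (0 if A is never hit, a null event) *)
Definition phiN (T : X -> X) (A : set X) (x : X) : nat :=
  match pselect (exists n, `[< hits T A x n >]) with
  | left h => ex_minn h
  | right _ => 0%N
  end.

(* first return map T_A x = T^{phi_A(x)} x (x itself if A is never hit) *)
Definition TA (T : X -> X) (A : set X) (x : X) : X := iter (phiN T A x) T x.

Definition PhiA (T : X -> X) (A : set X) (x : X) : nat -> \bar R :=
  fun k => phiA T A (iter k (TA T A) x).

Definition scaledPhiA (mu : probability X R) T A x : nat -> \bar R :=
  fun k => (mu A * PhiA T A x k)%E.

Definition PsiA {F : Type} (T : X -> X) (A : set X) (psi : X -> F) (x : X)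
  : nat -> F := fun k => psi (iter k.+1 (TA T A) x).

Definition PsitA {F : Type} (T : X -> X) (A : set X) (psi : X -> F) (x : X)
  : nat -> F := fun k => psi (iter k (TA T A) x).

Definition cond_int (mu : probability X R) (A : set X) (f : X -> \bar R)
  : \bar R := (((fine (mu A))^-1)%:E * \int[mu]_(x in A) f x)%E.

Definition cond_prob (mu : probability X R) (A B : set X) : R :=
  fine (mu (A `&` B)) / fine (mu A).

Definition push_cond (mu : probability X R) (T : X -> X) (tau : X -> nat)
  (A : set X) : set X -> \bar R :=
  fun B => (cond_prob mu A ((fun x => iter (tau x) T x) @^-1` B))%:E.

Definition in_P (mu : probability X R) (nu : set X -> \bar R) :=
  [/\ nu set0 = 0%E, (forall B, measurable B -> (0 <= nu B)%E),
      semi_sigma_additive nu, nu setT = 1%E &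
      forall B, measurable B -> mu B = 0%E -> nu B = 0%E].

Definition dP (nu nu' : set X -> \bar R) : \bar R :=
  (2%:E * ereal_sup [set `|(nu B - nu' B)%E| | B in [set B | measurable B]])%E.

(* compact subset of the metric space (P, d_P)
   (sequential compactness, equivalent to compactness in a metric space) *)
Definition compact_P (mu : probability X R) (K : set (set X -> \bar R)) :=
  K `<=` in_P mu /\
  forall s : nat -> (set X -> \bar R), (forall n, K (s n)) ->
    exists (phi : nat -> nat) (nu : set X -> \bar R),
      (forall n, (phi n < phi n.+1)%N) /\ K nu /\
      (fun n => dP (s (phi n)) nu) @ \oo --> 0%E.

End Defs.

Definition borel_meas_on {d} {X : measurableType d} {F : topologicalType}
  (D : set X) (f : X -> F) :=
  forall U : set F, open U -> measurable (D `&` f @^-1` U).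

Definition borel_set {F : topologicalType} (C : set F) :=
  smallest (sigma_algebra setT) [set U : set F | open U] C.

Definition bcont {R : realType} {F : topologicalType}
  (g : ({ptws nat -> \bar R} * {ptws nat -> F})%type -> R) :=
  continuous g /\ exists M : R, forall z, `|g z| <= M.

Definition exp_iid_pair {R : realType} {d'} {Omega : measurableType d'}
  {F : topologicalType} (P : probability Omega R)
  (E : nat -> Omega -> R) (Y : nat -> Omega -> F) :=
  [/\ (forall k, measurable_fun setT (E k)),
      (forall k, borel_meas_on setT (Y k)),
      (forall k B, measurable B -> P (E k @^-1` B) = exponential_prob 1 B),
      (forall k C, borel_set C -> P (Y k @^-1` C) = P (Y 0%N @^-1` C)) &
      (forall (n : nat) (B : nat -> set R) (C : nat -> set F),
         (forall k, measurable (B k)) -> (forall k, borel_set (C k)) ->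
         P (\bigcap_(k in [set k | (k < n)%N]) (E k @^-1` B k `&` Y k @^-1` C k))
         = (\prod_(0 <= k < n) (P (E k @^-1` B k) * P (Y k @^-1` C k)))%E)].

(* Main.v *)
Require Import Defs.
From HB Require Import structures.
From mathcomp Require Import all_boot all_order all_algebra.
From mathcomp Require Import ring lra.
From mathcomp Require Import all_classical all_reals all_analysis.
From mathcomp Require Import measurable_realfun.
Import Order.TTheory GRing.Theory Num.Theory.
Import numFieldNormedType.Exports.
Local Open Scope classical_set_scope.
Local Open Scope ring_scope.
Set Implicit Arguments.
Unset Strict Implicit.
Unset Printing Implicit Defensive.
Set SsrOldRewriteGoalsOrder.

(** Fix [a > 0], write [m = mu A] and [q = exp (- a m)].  For a bounded [f] on
[A] put [U x = q ^ phi_A x * f (T_A x)].  If [T x] misses [A] then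
[U (T x) = q^-1 U x], and if it hits [A] then [U x = q f (T x)].  Integrating
over the invariant measure,
  [(q^-1 - 1) * int U dmu = int_A f dmu - int_A U dmu].
With [f = g (m Phi_A, Psit_A)] this relates, for every bounded continuous [g],
the hitting expectation of [exp (- a Phi_0) g (shift Phi, Psi)] to the return
expectations of [g] and of [exp (- a Phi_0) g (shift Phi, shift Psi)]; the
factor [(q^-1 - 1) / m] tends to [a].  For the limit law both damped
expectations equal that of [g] divided by [1 + a].

From hitting to return: with [g = 1] the damped return expectation tends to
[1 / (1 + a)], hence is negligible as [a] grows, and the identity yields the
limit of the return expectation of [g].  From return to hitting: the identity
gives the limit on all functions [exp (- a Phi_0) g (shift Phi, Psi)]; letting
[a] tend to [0] removes the damping, and by Bernstein approximation in the
variable [exp (- Phi_0)] every continuous function on the compact path space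
is a uniform limit of combinations of these. *)

(** * Borel sets *)

Lemma borel_setT (F : topologicalType) : borel_set [set: F].
Proof. by apply: sub_sigma_algebra; exact: openT. Qed.

Lemma borel_setC (F : topologicalType) (A : set F) :
  borel_set A -> borel_set (~` A).
Proof. by rewrite -setTD; exact: sigma_algebraCD. Qed.

Lemma borel_setI (F : topologicalType) (A B : set F) :
  borel_set A -> borel_set B -> borel_set (A `&` B).
Proof.
move=> bA bB; have [] := (@sigma_algebraP _ setT (@borel_set F) _).1 => //.
exact: smallest_sigma_algebra.
by move=> _ _ _; exact.
Qed.

Lemma borel_setU (F : topologicalType) (A B : set F) :
  borel_set A -> borel_set B -> borel_set (A `|` B).
Proof.
by move=> bA bB; rewrite -[_ `|` _]setCK setCU; apply: borel_setC;
  apply: borel_setI; exact: borel_setC.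
Qed.

Lemma borel_set_preimage {d} {X : measurableType d} {F : topologicalType}
    (D : set X) (f : X -> F) : measurable D -> borel_meas_on D f ->
  forall C, borel_set C -> measurable (D `&` f @^-1` C).
Proof.
move=> mD mf; apply: smallest_sub; last by move=> U; exact: mf.
split=> [|C mC|C mC].
- by rewrite preimage_set0 setI0.
- rewrite setTD (_ : _ `&` _ = D `\` (D `&` f @^-1` C)); first exact: measurableD.
  by rewrite setDIr setDv set0U preimage_setC setDE.
- by rewrite preimage_bigcup setI_bigcupr; exact: bigcupT_measurable.
Qed.

(** * Topology and measurability on the extended real line *)

Section ereal_borel.
Context {R : realType}.

(** Balls of [\bar R] are measured through [contract], and [contract] after [expand] is the clipping
    to [[-1, 1]], which is 1-Lipschitz. *)
Lemma expand_continuous : continuous (@expand R).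
Proof.
move=> u; apply/cvg_ballP => e e0; near=> v.
rewrite /ball/= /ereal_ball.
have clip (w : R) : contract (expand w) = Num.max (-1) (Num.min w 1).
  rewrite /expand; case: ifPn => [w1|].
    by rewrite min_r//= max_r// lerN10.
  rewrite -ltNge => w1; case: ifPn => [w2|].
    by rewrite min_l ?(ltW w1)// max_l.
  rewrite -ltNge => w2; rewrite min_l ?(ltW w1)// max_r ?(ltW w2)//.
  have := @expandK R w; rewrite inE ler_norml (ltW w1) (ltW w2) => /(_ isT).
  by rewrite {1}/expand leNgt w1/= leNgt w2.
have lip (a b : R) : `|Num.max (-1) (Num.min a 1) - Num.max (-1) (Num.min b 1)|
    <= `|a - b|.
  have lip1 (c x y : R) : `|Num.max c x - Num.max c y| <= `|x - y|.
    have := ler_norm (x - y); have := ler_norm (y - x); rewrite (distrC y x).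
    rewrite ler_norml.
    by case: (leP c x) => ?; case: (leP c y) => ? ? ?; apply/andP; split; lra.
  apply: le_trans (lip1 _ _ _) _; have := lip1 (-1) (-a) (-b).
  by rewrite -!oppr_min -!opprD !normrN (minC 1) (minC 1).
rewrite !clip; apply: le_lt_trans (lip _ _) _.
by near: v; exact: cvgr_dist_lt.
Unshelve. all: by end_near. Qed.

Lemma ereal_compact : compact [set: \bar R].
Proof.
have <- : @expand R @` `[-1, 1] = setT.
  apply/seteqP; split=> // x _; exists (contract x); last exact: contractK.
  by rewrite /= in_itv/= -ler_norml contract_le1.
apply: continuous_compact; last exact: segment_compact.
by apply: continuous_subspaceT; exact: expand_continuous.
Qed.

(** The trace of [U] on the reals is open, and only the two infinite points remain to be added. *)
Lemma ereal_open_measurable (U : set (\bar R)) : open U -> measurable U.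
Proof.
move=> oU.
have oV : open (EFin @^-1` U).
  rewrite openE => r Ur; rewrite openE in oU; exact: oU Ur.
have UE : U = (EFin @` (EFin @^-1` U)) `|` (U `&` [set -oo%E])
    `|` (U `&` [set +oo%E]).
  apply/seteqP; split => [[r||] Ux|x];
    [by left; left; exists r|by right|by left; right|].
  by case=> [[[r Ur <-]//|[]//]|[]].
have s1 (z : \bar R) : measurable (U `&` [set z]).
  have [Uz|nUz] := pselect (U z); first by rewrite setIidr// => x /= ->.
  rewrite (_ : _ `&` _ = set0)//; apply/seteqP; split=> // x [Ux xz].
  by rewrite xz in Ux.
rewrite UE; apply: measurableU => //; apply: measurableU => //.
by apply: measurable_image_EFin; exact: open_measurable.
Qed.

Lemma ereal_borel_measurable (B : set (\bar R)) : borel_set B -> measurable B.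
Proof.
apply: smallest_sub; last exact: ereal_open_measurable.
by split=> [|C mC|C mC]; [|rewrite setTD; exact: measurableC|
  exact: bigcupT_measurable].
Qed.

End ereal_borel.

(** * The path space and its cylinder sigma-algebra *)

Section nets.
Context {R : realType} {T : pseudoMetricType R}.
Hypothesis cT : compact [set: T].

(** Interiors replace balls because balls of a pseudometric space need not be open, while the cells
    built from the net have to be Borel. *)
Lemma compact_net (e : R) : 0 < e ->
  exists s : seq T, forall y, exists2 c, c \in s & (ball c e)° y.
Proof.
move=> e0.
(* The filter of families that contain every superset of some finite set. Near-covering compactness
   along it turns the one-point nets around each [x] into a finite net of the whole space. *)
pose big : set_system (set T) :=
  [set W | exists s : seq T, forall S : set T, {in s, forall x, S x} -> W S].
have Fbig : Filter big.
  split=> [|P Q [s sP] [t tQ]|P Q PQ [s sP]].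
  - by exists [::].
  - exists (s ++ t) => u su; split; [apply: sP|apply: tQ] => x xs;
      by apply: su; rewrite mem_cat xs ?orbT.
  - by exists s => t /sP/PQ.
have := (compact_near_coveringP _).1 cT (set T) big
  (fun S y => exists2 c, S c & (ball c e)° y) Fbig.
case=> [x _|s /(_ [set` s]) h].
  exists ((ball x e)°, [set S | S x]); last by move=> [y S] [/= ? ?]; exists x.
  split => /=; last by exists [:: x] => S; apply; rewrite mem_head.
  by apply: nbhs_interior; exact: nbhsx_ballx.
by exists s => y; apply: h.
Qed.

(** A Borel quantizer of the space: the first net point whose open cell contains [y], with value
    [size s] if there is none. *)
Definition net_index (s : seq T) (e : R) (y : T) : nat :=
  find (fun c => `[< (ball c e)° y >]) s.

Lemma net_index_ball (y0 : T) s e y :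
  (exists2 c, c \in s & (ball c e)° y) ->
  ball (nth y0 s (net_index s e y)) e y.
Proof.
move=> [c cs cy]; apply: interior_subset; apply/asboolP.
by apply: (nth_find y0 (a := fun c => `[< (ball c e)° y >]));
  apply/hasP; exists c => //; apply/asboolP.
Qed.

Lemma borel_net_index s e (V : set nat) : borel_set (net_index s e @^-1` V).
Proof.
elim: s V => [|c s IH] V.
  rewrite /net_index/= preimage_cst; case: ifP => _; first exact: borel_setT.
  exact: sigma_algebra0.
have bc : borel_set (ball c e)° by apply: sub_sigma_algebra; exact: open_interior.
rewrite (_ : _ @^-1` V = ((ball c e)° `&` [set _ | V 0%N]) `|`
    (~` (ball c e)° `&` (net_index s e @^-1` (S @^-1` V)))).
  apply: borel_setU; apply: borel_setI => //; last exact: borel_setC.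
  have [V0|V0] := pselect (V 0%N).
    by rewrite (_ : [set _ | _] = setT); [exact: borel_setT|apply/seteqP; split].
  by rewrite (_ : [set _ | _] = set0); [exact: sigma_algebra0|apply/seteqP; split].
apply/seteqP; split=> y; rewrite /preimage /net_index/=.
  by case: asboolP; [left|right].
by case: asboolP => ? [[]|[]].
Qed.

End nets.

(** Every preimage is a countable union of fibres of [i], so [h] can be arbitrary. *)
Lemma measurable_fun_count d (X : measurableType d) (R : realType)
    (C : countType) (i : X -> C) (h : C -> R) :
  (forall t, measurable (i @^-1` [set t])) -> measurable_fun setT (h \o i).
Proof.
move=> mi _ V _; rewrite setTI.
rewrite (_ : _ @^-1` V = \bigcup_t (i @^-1` [set t] `&` [set _ | V (h t)])).
  apply: countable_bigcupT_measurable => // t.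
  have [Vt|Vt] := pselect (V (h t)).
    by rewrite (_ : [set _ | _] = setT) ?setIT//; apply/seteqP; split.
  by rewrite (_ : [set _ | _] = set0) ?setI0//; apply/seteqP; split.
by apply/seteqP; split=> [x Vx|x [t _ [/= <-]]]; first by exists (i x).
Qed.

Notation path_space R F := ({ptws nat -> \bar R} * {ptws nat -> F})%type.

Section path.
Context {R : realType} {F : pseudoMetricType R}.

(** A separate name for the path space, to which a base point built from [y0] is attached so that
    [mpath] becomes a measurable type. *)
Definition pointed_path (y0 : F) : Type := path_space R F.
HB.instance Definition _ (y0 : F) := Choice.on (pointed_path y0).
HB.instance Definition _ (y0 : F) :=
  isPointed.Build (pointed_path y0) (fun=> 0%E, fun=> y0).

Definition cylinder n (B : nat -> set (\bar R)) (C : nat -> set F)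
  : set (path_space R F) :=
  [set z | forall k, (k < n)%N -> B k (z.1 k) /\ C k (z.2 k)].

Definition cylinders : set (set (path_space R F)) :=
  [set D | exists n B C, [/\ forall k, measurable (B k),
     forall k, borel_set (C k) & D = cylinder n B C]].

(** Generated by finite rectangles, the sets on which [exp_iid_pair] prescribes the joint law. *)
Definition mpath (y0 : F) := g_sigma_algebraType (cylinders : set (set (pointed_path y0))).

Lemma measurable_coord1 (y0 : F) k (B : set (\bar R)) : measurable B ->
  measurable ([set z | B (z.1 k)] : set (mpath y0)).
Proof.
move=> mB; apply: sub_sigma_algebra.
exists k.+1, (fun j => if j == k then B else setT), (fun=> setT); split.
- by move=> j; case: ifP.
- by move=> j; exact: borel_setT.
- apply/seteqP; split=> z /= h; last by have [] := h k (ltnSn k); rewrite eqxx.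
  by move=> j _; split=> //; case: eqP => // ->.
Qed.

Lemma measurable_coord2 (y0 : F) k (C : set F) : borel_set C ->
  measurable ([set z | C (z.2 k)] : set (mpath y0)).
Proof.
move=> mC; apply: sub_sigma_algebra.
exists k.+1, (fun=> setT), (fun j => if j == k then C else setT); split.
- by [].
- by move=> j; case: ifP => _ //; exact: borel_setT.
- apply/seteqP; split=> z /= h; last by have [] := h k (ltnSn k); rewrite eqxx.
  by move=> j _; split=> //; case: eqP => // ->.
Qed.

(** The domain [D] is kept general because the path maps of the dynamical system are controlled only
    on recurrent points. *)
Lemma measurable_path d (X : measurableType d) (y0 : F) (D : set X)
    (Z : X -> mpath y0) : measurable D ->
  (forall k, measurable_fun D (fun x => (Z x).1 k)) ->
  (forall k, borel_meas_on D (fun x => (Z x).2 k)) -> measurable_fun D Z.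
Proof.
move=> mD m1 m2; apply: (@measurability _ _ X (mpath y0) D Z cylinders) => // _ [_ [n [B [C [mB mC ->]]]] <-].
rewrite (_ : _ `&` _ = \bigcap_(k in [set k | (k < n)%N])
   ((D `&` (fun x => (Z x).1 k) @^-1` B k) `&`
    (D `&` (fun x => (Z x).2 k) @^-1` C k)) `&` D).
  apply: measurableI => //; apply: bigcap_measurableType => k _.
  by apply: measurableI; [exact: m1|exact: borel_set_preimage].
apply/seteqP; split=> [x [Dx Zx]|x [h Dx]].
  by split=> // k kn; have [? ?] := Zx k kn; split.
by split=> // k kn; have [[_ ?] [_ ?]] := h k kn; split.
Qed.

Hypothesis cF : compact [set: F].

Lemma ptws_pair_cvg I (G : set_system I) (FG : Filter G)
    (u : I -> path_space R F) (z : path_space R F) :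
  (forall k, (u i).1 k @[i --> G] --> z.1 k) ->
  (forall k, (u i).2 k @[i --> G] --> z.2 k) -> u @ G --> z.
Proof.
move=> h1 h2; case: z h1 h2 => z1 z2 /= h1 h2.
rewrite (_ : u = fun n => ((u n).1, (u n).2)); last first.
  by apply/funext => n; rewrite -surjective_pairing.
apply: (@cvg_pair _ _ _ _ (nbhs (z1 : {ptws nat -> \bar R}))
  (nbhs (z2 : {ptws nat -> F}))).
  by apply/pointwise_cvgP => t; exact: h1.
by apply/pointwise_cvgP => t; exact: h2.
Qed.

(** Quantizing the first [n] coordinates by finite nets of mesh [1 / (n + 1)] gives countably valued
    measurable maps that converge pointwise to the identity, and [g] is the limit of its
    compositions with them. *)
Lemma measurable_bcont (y0 : F) (g : path_space R F -> R) :
  continuous g -> measurable_fun setT (g : mpath y0 -> R).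
Proof.
move=> cg.
have n0 (n : nat) : (0 < n.+1%:R^-1 :> R) by rewrite invr_gt0.
have /choice[s1 s1P] : forall n : nat, exists s : seq (\bar R),
    forall y, exists2 c, c \in s & (ball c (n.+1%:R^-1 : R))° y.
  by move=> n; exact: compact_net ereal_compact _ (n0 n).
have /choice[s2 s2P] : forall n : nat, exists s : seq F,
    forall y, exists2 c, c \in s & (ball c (n.+1%:R^-1 : R))° y.
  by move=> n; exact: compact_net cF _ (n0 n).
pose e n : R := n.+1%:R^-1.
pose code n (z : mpath y0) : seq (nat * nat) :=
  [seq (net_index (s1 n) (e n) (z.1 k), net_index (s2 n) (e n) (z.2 k))
  | k <- iota 0 n].
(* Coordinates from [n] on receive an arbitrary value, which the product topology does not see in
   the limit. *)
pose dec n (t : seq (nat * nat)) : path_space R F :=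
  (fun k => nth 0%E (s1 n) (nth (0, 0)%N t k).1,
   fun k => nth y0 (s2 n) (nth (0, 0)%N t k).2).
apply: (@measurable_fun_cvg _ _ _ _ (fun n => (g \o dec n) \o code n)).
  move=> n; apply: measurable_fun_count => t.
  rewrite /code; elim: (iota 0 n) t => [|k l IH] [|p t].
  - by rewrite (_ : _ @^-1` _ = setT)//; apply/seteqP; split.
  - by rewrite (_ : _ @^-1` _ = set0)//; apply/seteqP; split.
  - by rewrite (_ : _ @^-1` _ = set0)//; apply/seteqP; split.
  rewrite (_ : _ @^-1` _ = [set z | (net_index (s1 n) (e n) @^-1` [set p.1]) (z.1 k)]
     `&` [set z | (net_index (s2 n) (e n) @^-1` [set p.2]) (z.2 k)]
     `&` (fun z : mpath y0 => [seq (net_index (s1 n) (e n) (z.1 k),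
         net_index (s2 n) (e n) (z.2 k)) | k <- l]) @^-1` [set t]).
    apply: measurableI (IH t); apply: measurableI.
      by apply: measurable_coord1; apply: ereal_borel_measurable; exact: borel_net_index.
    by apply: measurable_coord2; exact: borel_net_index.
  case: p => p1 p2; apply/seteqP; split=> z; rewrite /preimage/=.
    by case=> -> -> ->.
  by move=> [[-> ->] ->].
move=> z _; apply: continuous_cvg; first exact: cg.
have e0 (r : R) : 0 < r -> \forall n \near \oo, e n < r.
  move=> r0; have := @cvg_harmonic R => /cvgr0Pnorm_lt/(_ _ r0).
  by apply: filterS => n; apply: le_lt_trans; rewrite ler_norm.
apply: ptws_pair_cvg => k; apply/cvg_ballP => r r0; near=> n.
  have kn : (k < n)%N by near: n; exact: nbhs_infty_gt.
  rewrite /= (nth_map 0%N) ?size_iota// nth_iota// add0n.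
  apply: ball_sym; apply: (@le_ball _ _ _ (e n)); last exact: net_index_ball.
  by apply: ltW; near: n; exact: e0.
have kn : (k < n)%N by near: n; exact: nbhs_infty_gt.
rewrite /= (nth_map 0%N) ?size_iota// nth_iota// add0n.
apply: ball_sym; apply: (@le_ball _ _ _ (e n)); last exact: net_index_ball.
by apply: ltW; near: n; exact: e0.
Unshelve. all: by end_near. Qed.

End path.

(** * Exponential damping *)

Section density.
Context d (X : measurableType d) (R : realType).
Variables (m nu : {measure set X -> \bar R}) (p : X -> R).
Hypotheses (mp : measurable_fun setT p) (p0 : forall x, 0 <= p x).
Hypothesis nuE : forall A, measurable A -> nu A = (\int[m]_(x in A) (p x)%:E)%E.
Local Open Scope ereal_scope.
Import HBNNSimple.

Let integral_density_nnsfun (f : {nnsfun X >-> R}) :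
  \int[nu]_x (f x)%:E = \int[m]_x ((f x)%:E * (p x)%:E).
Proof.
under [LHS]eq_integral do rewrite fimfunE -fsumEFin//.
rewrite [LHS]ge0_integral_fsum//; last 2 first.
  - by move=> r; exact/measurable_EFinP/measurableT_comp.
  - by move=> n x _; rewrite EFinM nnfun_muleindic_ge0.
under [RHS]eq_integral.
  move=> x xD; rewrite muleC fimfunE -fsumEFin// ge0_mule_fsumr; last first.
    by move=> r; rewrite EFinM nnfun_muleindic_ge0.
  over.
rewrite [RHS]ge0_integral_fsum//; last 2 first.
  - move=> r; apply: emeasurable_funM; first exact/measurable_EFinP.
    by apply/measurable_EFinP; exact: measurableT_comp.
  - move=> n x _; apply: mule_ge0; first by rewrite lee_fin.
    by rewrite EFinM nnfun_muleindic_ge0.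
apply: eq_fsbigr => r _; rewrite integralZl_indic_nnsfun// integral_indic//.
rewrite setIT nuE//.
have [r0|r0] := leP 0%R r; last first.
  rewrite preimage_nnfun0//.
  rewrite integral_set0 mule0 integral0_eq// => x _.
  by rewrite indic0 mulr0 mule0.
rewrite -ge0_integralZl//; last 2 first.
- exact/measurable_EFinP/measurable_funTS.
- by move=> x _; rewrite lee_fin.
rewrite integral_mkcond; apply: eq_integral => x _; rewrite patchE indicE.
by case: ifPn => _; rewrite ?mulr1 ?mulr0 ?mule0// muleC.
Qed.

(** The formula for simple functions passes to the limit by monotone convergence on both sides. *)
Lemma integral_density (f : X -> \bar R) :
  measurable_fun setT f -> (forall x, 0 <= f x) ->
  \int[nu]_x f x = \int[m]_x (f x * (p x)%:E).
Proof.
move=> mf f0; pose f_ := nnsfun_approx measurableT mf.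
have cvgf x : (f_ n x)%:E @[n --> \oo] --> f x by exact: cvg_nnsfun_approx.
have ndf x i j : (i <= j)%N -> (f_ i x <= f_ j x)%R.
  by move=> ij; exact/lefP/nd_nnsfun_approx.
transitivity (lim (\int[nu]_x (f_ n x)%:E @[n --> \oo])).
  rewrite -monotone_convergence//=.
  - by apply: eq_integral => x _; apply/esym/cvg_lim.
  - by move=> n; exact/measurable_EFinP.
  - by move=> n x _; rewrite lee_fin.
  - by move=> x _ i j ij; rewrite lee_fin ndf.
transitivity (lim (\int[m]_x ((f_ n x)%:E * (p x)%:E) @[n --> \oo])).
  by apply: congr_lim; apply/funext => n; exact: integral_density_nnsfun.
rewrite -monotone_convergence//=.
- apply: eq_integral => x _; apply/cvg_lim => //.
  by apply: cvgeZr.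
- move=> n; apply: emeasurable_funM; exact/measurable_EFinP.
- by move=> n x _; rewrite -EFinM lee_fin mulr_ge0.
- by move=> x _ i j ij; rewrite -!EFinM lee_fin ler_wpM2r// ndf.
Qed.

End density.

Section damping.
Context {R : realType}.

(* Constant on negative times, which keeps it bounded on the whole of [\bar R]. *)
Definition dexp (a : R) (s : \bar R) : R :=
  match s with
  | r%:E => expR (- (a * Num.max r 0))
  | +oo%E => 0
  | -oo%E => 1
  end.

Lemma dexp_ge0 a s : 0 <= dexp a s.
Proof. by case: s => [r||] //=; exact: expR_ge0. Qed.

Lemma dexp_le1 a s : 0 <= a -> dexp a s <= 1.
Proof.
move=> a0; case: s => [r||] //=.
by rewrite -expR0 ler_expR oppr_le0 mulr_ge0// le_max lexx orbT.
Qed.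

(** Positivity of [a] makes the value 0 at [+oo] the limit of the finite values. *)
Lemma dexp_continuous a : 0 < a -> continuous (dexp a).
Proof.
move=> a0 [r||].
- have cr : {for r, continuous (fun x : R => expR (- (a * Num.max x 0)))}.
    apply: continuous_comp; last exact: continuous_expR.
    apply: continuousN; apply: continuousM; first exact: cst_continuous.
    by apply: continuous_max; [exact: cvg_id|exact: cst_continuous].
  by move=> U /cr Ur; apply/nbhs_EFin.
- move=> U U0; apply/nbhs_ereal_pinfty; split; first exact: nbhs_singleton U0.
  have h : expR (- (a * x)) @[x --> +oo] --> (0 : R).
    apply: (@cvg_comp _ _ _ (fun x => a * x) (fun x => expR (- x)) _
      (pinfty_nbhs R)); last exact: cvgr_expR.
    by apply: gt0_cvgMry => //; exact: cvg_id.
  near=> x; rewrite /= max_l; first by near: x; exact: h.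
  by near: x; apply: nbhs_pinfty_ge; exact: num_real.
- move=> U U0; apply/nbhs_ereal_ninfty; split; first exact: nbhs_singleton U0.
  near=> x; rewrite /= max_r ?mulr0 ?oppr0 ?expR0; first exact: nbhs_singleton U0.
  by near: x; apply: nbhs_ninfty_le; exact: num_real.
Unshelve. all: by end_near. Qed.

Lemma measurable_dexp_fin a : measurable_fun setT (fun r : R => dexp a r%:E).
Proof.
rewrite /=; apply: measurableT_comp => //; apply: measurableT_comp => //.
by apply: measurable_funM => //; apply: measurable_maxr.
Qed.

(** [exp (- a x)] times the exponential density of rate 1 is [(1 + a)^-1] times the density of rate
    [1 + a], which has integral 1. *)
Lemma laplace_exponential a : 0 < a ->
  (\int[exponential_prob (1 : R)]_x (dexp a x%:E)%:E = ((1 + a)^-1)%:E)%E.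
Proof.
move=> a0; have a1 : 0 < 1 + a by rewrite ltr_wpDl.
rewrite (@integral_density _ _ _ lebesgue_measure _ (exponential_pdf 1))//.
- transitivity (\int[lebesgue_measure]_x
    ((1 + a)^-1%:E * (exponential_pdf (1 + a) x)%:E))%E.
    apply: eq_integral => x _; rewrite -!EFinM; congr (_%:E).
    have [x0|x0] := leP 0 x; last by rewrite !lt0_exponential_pdf// !mulr0.
    rewrite !exponential_pdfE// mulKf ?gt_eqF//= max_l// mul1r -expRD.
    by congr expR; rewrite !mulNr mul1r mulrDl mul1r opprD addrC.
  rewrite ge0_integralZl//.
  + by rewrite integral_exponential_pdf// mule1.
  + by apply/measurable_EFinP; exact: measurable_exponential_pdf.
  + by move=> x _; rewrite lee_fin exponential_pdf_ge0// ltW.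
  + by rewrite lee_fin invr_ge0 ltW.
- exact: measurable_exponential_pdf.
- by move=> x; exact: exponential_pdf_ge0.
- by apply/measurable_EFinP; exact: measurable_dexp_fin.
- by move=> x; rewrite lee_fin dexp_ge0.
Qed.

End damping.

Section bounded_integrable.
Context d (X : measurableType d) (R : realType) (m : {measure set X -> \bar R}).

Lemma bounded_integrable (D : set X) (f : X -> R) (M : R) :
  measurable D -> (m D < +oo)%E -> measurable_fun D f ->
  (forall x, D x -> `|f x| <= M) -> m.-integrable D (EFin \o f).
Proof.
move=> mD fD mf fM; apply: measurable_bounded_integrable => //.
exists M; split; first exact: num_real.
by move=> N MN x /= Dx; apply: le_trans (fM _ Dx) (ltW MN).
Qed.

End bounded_integrable.

Section independent_product.
Context {R : realType} {d d1 d2 : measure_display} {Omega : measurableType d}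
  {T1 : measurableType d1} {T2 : measurableType d2}.
Variables (P : probability Omega R) (X : {mfun Omega >-> T1})
  (Z : {mfun Omega >-> T2}) (L : probability T2 R).
Hypothesis indep : forall A B, measurable A -> measurable B ->
  P (X @^-1` A `&` Z @^-1` B) = (P (X @^-1` A) * L B)%E.

(** By uniqueness on rectangles the joint law of [X] and [Z] is the product of the law of [X] with
    [L], and Fubini applies. In the application [L] is given as the law of another variable than
    [Z]. *)
Lemma integral_independent (h : T1 -> R) (g : T2 -> R) (M N : R) :
  measurable_fun setT h -> (forall x, `|h x| <= M) ->
  measurable_fun setT g -> (forall y, `|g y| <= N) ->
  (\int[P]_w (h (X w) * g (Z w))%:E =
   \int[P]_w (h (X w))%:E * \int[L]_y (g y)%:E)%E.
Proof.
move=> mh hM mg gN.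
have M0 : 0 <= M by apply: le_trans (hM (X point)).
have mXZ : measurable_fun setT (fun w => (X w, Z w)) by exact: measurable_fun_pair.
pose XZ : {mfun Omega >-> (T1 * T2)%type} :=
  HB.pack (fun w => (X w, Z w)) (isMeasurableFun.Build _ _ _ _ _ mXZ).
pose m1 : probability T1 R := distribution P X.
have XZE A : measurable A -> (m1 \x L)%E A = distribution P XZ A.
  apply: product_measure_unique => B C mB mC; rewrite -indep//.
pose f (z : T1 * T2) := h z.1 * g z.2.
have mf : measurable_fun setT f.
  by apply: measurable_funM; apply: measurableT_comp.
have fMN z : `|f z| <= M * N by rewrite normrM ler_pM.
have If : (m1 \x L)%E.-integrable setT (EFin \o f).
  apply: (@bounded_integrable _ _ _ _ _ _ (M * N)) => //.
  by rewrite /= XZE//= ltey_eq fin_num_measure.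
have Ig : L.-integrable setT (EFin \o g).
  by apply: (@bounded_integrable _ _ _ _ _ _ N) => //=; rewrite ltey_eq fin_num_measure.
have Ih : m1.-integrable setT (EFin \o h).
  by apply: (@bounded_integrable _ _ _ _ _ _ M) => //=; rewrite ltey_eq fin_num_measure.
transitivity (\int[distribution P XZ]_z (EFin \o f) z)%E.
  rewrite integral_distribution//; first exact/measurable_EFinP.
  apply: (@bounded_integrable _ _ _ _ _ _ (M * N)) => //.
    by rewrite /= ltey_eq fin_num_measure.
  by apply: measurableT_comp mf mXZ.
rewrite (eq_measure_integral (m1 \x L)%E); last first.
  by move=> A mA _; apply/esym; exact: XZE.
rewrite -integral12_prod_meas1//.
have gE : (\int[L]_y (g y)%:E)%E = (\int[L]_y g y)%:E.
  by rewrite /Rintegral fineK//; exact: integrable_fin_num.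
rewrite gE muleC.
transitivity (\int[m1]_x ((\int[L]_y g y)%:E * (h x)%:E))%E.
  apply: eq_integral => x _; rewrite /fubini_F /f/=.
  under eq_integral do rewrite EFinM.
  by rewrite integralZl// gE muleC.
rewrite integralZl//; congr (_ * _)%E.
rewrite integral_distribution//; first exact/measurable_EFinP.
apply: (@bounded_integrable _ _ _ _ _ _ M) => //.
  by rewrite /= ltey_eq fin_num_measure.
exact: measurableT_comp.
Qed.

End independent_product.

Section cylinder_unique.
Context {R : realType} {F : pseudoMetricType R} (y0 : F).

Lemma setI_closed_cylinders : setI_closed (@cylinders R F).
Proof.
move=> _ _ [n [B [C [mB mC ->]]]] [n' [B' [C' [mB' mC' ->]]]].
exists (maxn n n'),
  (fun k => (if (k < n)%N then B k else setT) `&` (if (k < n')%N then B' k else setT)),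
  (fun k => (if (k < n)%N then C k else setT) `&` (if (k < n')%N then C' k else setT)).
split.
- by move=> k; apply: measurableI; case: ifP.
- by move=> k; apply: borel_setI; case: ifP => // _; exact: borel_setT.
apply/seteqP; split=> [z [h h'] k _|z h].
  split; split; case: ifP => // kn.
  + by have [] := h k kn. + by have [] := h' k kn.
  + by have [] := h k kn. + by have [] := h' k kn.
split=> k kn; have := h k; rewrite leq_max kn ?orbT => /(_ isT)/= [[? ?] [? ?]];
  by split.
Qed.

Lemma mpath_measure_unique (m1 m2 : {measure set (mpath y0) -> \bar R}) :
  (m1 setT < +oo)%E ->
  (forall n B C, (forall k, measurable (B k)) -> (forall k, borel_set (C k)) ->
    m1 (cylinder n B C) = m2 (cylinder n B C)) ->
  forall A, measurable A -> m1 A = m2 A.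
Proof.
move=> fm h A mA.
apply: (@measure_unique _ _ (mpath y0) (@cylinders R F) (fun=> setT)) => //.
- exact: setI_closed_cylinders.
- move=> _; exists 0%N, (fun=> setT), (fun=> setT); split=> //.
    by move=> _; exact: borel_setT.
  by apply/seteqP; split=> // z.
- by rewrite bigcup_const//; exists 0%N.
- by move=> _ [n [B [C [mB mC ->]]]]; exact: h.
Qed.

End cylinder_unique.

(** * The limit law *)

Section limit_law.
Context {R : realType} {F : pseudoMetricType R} {d : measure_display}
  {Omega : measurableType d}.
Variables (P : probability Omega R) (E : nat -> Omega -> R) (Y : nat -> Omega -> F).
Hypotheses (cF : compact [set: F]) (iid : exp_iid_pair P E Y).

Let y0 : F := Y 0%N point.
Let Z0 (w : Omega) : mpath y0 := (fun k => (E k w)%:E, fun k => Y k w).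
(** The waiting times always lose their first entry; the marks do so exactly when [b] is true, read
    as the number 1. *)
Let Zs (b : bool) (w : Omega) : mpath y0 :=
  (fun k => (E k.+1 w)%:E, fun k => Y (b + k)%N w).

Let mE k : measurable_fun setT (E k). Proof. by have [] := iid. Qed.
Let mY k : borel_meas_on setT (Y k). Proof. by have [] := iid. Qed.

Let mZ0 : measurable_fun setT Z0.
Proof.
apply: measurable_path => // k.
by apply/measurable_EFinP; exact: (mE k).
Qed.

Let mZs b : measurable_fun setT (Zs b).
Proof.
apply: measurable_path => // k.
  by apply/measurable_EFinP; exact: (mE k.+1).
exact: (mY (b + k)%N).
Qed.

Let rect n (B : nat -> set R) (C : nat -> set F) :=
  \bigcap_(k in [set k | (k < n)%N]) (E k @^-1` B k `&` Y k @^-1` C k).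

Let prob_rect n B C :
  (forall k, measurable (B k)) -> (forall k, borel_set (C k)) ->
  P (rect n B C) = ((\prod_(0 <= k < n) P (E 0%N @^-1` B k)) *
    (\prod_(0 <= k < n) P (Y 0%N @^-1` C k)))%E.
Proof.
move=> mB mC; have [_ _ eE eY ind] := iid.
rewrite [LHS]ind// -big_split; apply: eq_bigr => k _.
by rewrite !eE// (eY k).
Qed.

Let indep_cylinder b A n (B : nat -> set (\bar R)) (C : nat -> set F) :
  measurable A -> (forall k, measurable (B k)) -> (forall k, borel_set (C k)) ->
  P (E 0%N @^-1` A `&` Zs b @^-1` cylinder n B C) =
  (P (E 0%N @^-1` A) * P (Z0 @^-1` cylinder n B C))%E.
Proof.
move=> mA mB mC.
have mB' k : measurable (EFin @^-1` B k).
  rewrite -[X in measurable X]setTI.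
  by have /measurable_EFinP := @measurable_id _ R setT; exact.
(* The event is a rectangle in [n + 1] coordinates. [A] constrains time 0 and the mark conditions
   move to the slots [b] to [n + b - 1], which leaves one slot free: the first if [b] is true, the
   last otherwise. *)
pose B1 k := if k is k'.+1 then EFin @^-1` B k' else A.
pose C1 k := if (b <= k)%N && (k < n + b)%N then C (k - b)%N else setT.
have mB1 k : measurable (B1 k) by case: k.
have mC1 k : borel_set (C1 k) by rewrite /C1; case: ifP => // _; exact: borel_setT.
rewrite (_ : Z0 @^-1` _ = rect n (fun k => EFin @^-1` B k) C); last first.
  by apply/seteqP; split=> w h k /h.
rewrite (_ : _ `&` _ = rect n.+1 B1 C1); last first.
  apply/seteqP; split=> [w [Aw h] [|k]|w h].
  - move=> _; split => //; rewrite /C1; case: ifP => // /andP[b0 bn].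
    have b00 : b = 0%N :> nat by move: b0; rewrite leqn0 => /eqP.
    rewrite b00 addn0 in bn; have [_] := h 0%N bn; rewrite /= addn0.
    by rewrite /preimage/= b00.
  - rewrite /= ltnS => kn; split; first by have [] := h k kn.
    rewrite /C1; case: ifP => // /andP[bk kbn].
    have kbn' : (k.+1 - b < n)%N by rewrite ltn_subLR// addnC.
    by have [_] := h _ kbn'; rewrite /= subnKC.
  split; first by have [] := h 0%N isT.
  move=> k kn; split; first by have [] := h k.+1 kn.
  have bkn : (b + k < n.+1)%N by case: (b) => /=; rewrite ?add0n ?add1n// ltnW.
  have [_] := h _ bkn; rewrite /preimage/= /C1 leq_addr /= addnC ltn_add2r kn/=.
  by rewrite addnK addnC.
rewrite !prob_rect// muleA.
have -> : (\prod_(0 <= k < n.+1) P (E 0%N @^-1` B1 k) =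
    P (E 0%N @^-1` A) * \prod_(0 <= k < n) P (E 0%N @^-1` (EFin @^-1` B k)))%E.
  by rewrite big_nat_recl.
congr (_ * _)%E.
have PT : P (Y 0%N @^-1` setT) = 1%E by rewrite preimage_setT probability_setT.
case: (b) @C1 {mC1} => C1.
  rewrite big_nat_recl// {1}/C1/= PT mul1e; apply: eq_big_nat => k /andP[_ kn].
  by rewrite /C1/= addn1 ltnS kn subn1.
rewrite big_nat_recr//= {2}/C1/= addn0 ltnn PT mule1.
by apply: eq_big_nat => k /andP[_ kn]; rewrite /C1/= addn0 kn subn0.
Qed.

Let E0m : {mfun Omega >-> measurableTypeR R} :=
  HB.pack (E 0%N) (isMeasurableFun.Build _ _ Omega (measurableTypeR R) (E 0%N) (mE 0%N)).
Let Z0m : {mfun Omega >-> mpath y0} :=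
  HB.pack Z0 (isMeasurableFun.Build _ _ _ _ _ mZ0).
Let Zsm b : {mfun Omega >-> mpath y0} :=
  HB.pack (Zs b) (isMeasurableFun.Build _ _ _ _ _ (mZs b)).

(** For fixed [A] both sides are finite measures in [B]: the push-forward of [P] restricted to the
    event on [E 0], and a multiple of the law of [Z0]. They agree on cylinders, hence everywhere. *)
Let indep b A B : measurable A -> measurable B ->
  P (E0m @^-1` A `&` Zsm b @^-1` B) = (P (E0m @^-1` A) * distribution P Z0m B)%E.
Proof.
move=> mA mB; have mEA : measurable (E0m @^-1` A).
  by rewrite -[X in measurable X]setTI; exact: mE.
have r0 : 0 <= fine (P (E0m @^-1` A)) by exact: fine_ge0.
pose r : {nonneg R} := NngNum r0.
have rE : (r%:num)%:E = P (E0m @^-1` A) by rewrite /= fineK// fin_num_measure.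
rewrite -rE setIC.
pose m1' : {measure set (mpath y0) -> \bar R} :=
  pushforward (mrestr P mEA) (Zsm b).
pose m1 := m1' (mZs b).
pose m2 : {measure set (mpath y0) -> \bar R} := mscale r (distribution P Z0m).
rewrite -[RHS]/(m2 B) -[LHS]/(m1 B); apply: (@mpath_measure_unique _ _ y0) => //.
  rewrite /m1 /m1' /= /pushforward /mrestr preimage_setT setTI ltey_eq.
  by rewrite fin_num_measure.
move=> n C D mC mD; rewrite /m1 /m1' /m2 /= /pushforward /mrestr /mscale setIC rE.
exact: indep_cylinder.
Qed.

(** The shifted pair is independent of [E 0] and has the law of the whole pair, so the expectation
    factors through the Laplace transform of the exponential law. *)
Lemma exp_iid_damped (b : bool) (a : R) (g : path_space R F -> R) :
  0 < a -> bcont g ->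
  (\int[P]_w (dexp a (E 0%N w)%:E *
     g (fun k => (E k.+1 w)%:E, fun k => Y (b + k)%N w))%:E =
   ((1 + a)^-1)%:E * \int[P]_w (g (fun k => (E k w)%:E, fun k => Y k w))%:E)%E.
Proof.
move=> a0 [cg [M gM]].
rewrite (@integral_independent _ _ _ _ _ _ _ P E0m (Zsm b) (distribution P Z0m)
  (indep b) (fun r => dexp a r%:E) (g : mpath y0 -> R) 1 M)//.
- congr (_ * _)%E.
    have [_ _ eE _ _] := iid.
    rewrite -laplace_exponential//.
    rewrite -(@ge0_integral_distribution _ _ _ _ _ P E0m
        (fun r => (dexp a r%:E)%:E))//.
    + pose nu : {measure set (measurableTypeR R) -> \bar R} := exponential_prob (1 : R).
      apply: (@eq_measure_integral _ (measurableTypeR R) R setT (nu (@ltr01 _))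
        (distribution P E0m) (fun r => (dexp a r%:E)%:E)) => A mA _.
      exact: eE.
    + by apply/measurable_EFinP; exact: measurable_dexp_fin.
    + by move=> y; rewrite lee_fin dexp_ge0.
  rewrite integral_distribution//.
    by apply/measurable_EFinP; exact: measurable_bcont.
  apply: (@bounded_integrable _ _ _ _ _ _ M) => //.
    by rewrite /= ltey_eq fin_num_measure.
  by apply: measurableT_comp mZ0; exact: measurable_bcont.
- exact: measurable_dexp_fin.
- by move=> x; rewrite ger0_norm ?dexp_ge0// dexp_le1// ltW.
- exact: measurable_bcont.
Qed.

Lemma exp_iid_ge0 : P [set w | E 0%N w < 0] = 0%E.
Proof.
have [_ _ eE _ _] := iid.
rewrite (_ : [set w | _] = E 0%N @^-1` `]-oo, 0[); last first.
  by apply/seteqP; split=> w; rewrite /preimage/= in_itv.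
rewrite eE// /exponential_prob; apply: integral0_eq => x; rewrite /= in_itv/=.
by move=> x0; rewrite lt0_exponential_pdf.
Qed.

End limit_law.

(** * Recurrence and the induced map *)

Section integral_null.
Context d (X : measurableType d) (R : realType) (m : {measure set X -> \bar R}).
Local Open Scope ereal_scope.
Import HBNNSimple.

(** The supremum by which the integral of a nonnegative function is defined; it makes sense without
    measurability of [f]. *)
Let nn (f : X -> \bar R) := ereal_sup [set sintegral m h |
  h in [set h : {nnsfun X >-> R} | forall x, (h x)%:E <= f x]].

Let nn_le (N : set X) (f g : X -> \bar R) : measurable N -> m N = 0 ->
  (forall x, 0 <= g x) -> (forall x, ~ N x -> f x = g x) -> nn f <= nn g.
Proof.
move=> mN N0 g0 fg; apply: ge_ereal_sup => _ [h hf <-].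
(* Setting [h] to 0 on [N] leaves its integral unchanged and puts it below [g] everywhere. *)
pose h' := proj_nnsfun h (measurableC mN).
have h'E x : h' x = if x \in N then 0%R else h x.
  by rewrite /h' -mrestrict patchE in_setC; case: (x \in N).
have -> : sintegral m h = sintegral m h'.
  rewrite -!integralT_nnsfun; apply: ae_eq_integral => //.
  - exact/measurable_EFinP.
  - exact/measurable_EFinP.
  exists N; split => // x /= h1; apply: contrapT => Nx.
  by apply: h1 => _; rewrite mindicE in_setC memNset// mulr1.
apply: ereal_sup_ubound; exists h' => // x; rewrite h'E.
by case: ifPn => [_|/negP xN]; rewrite ?g0// -fg//; move=> Nx; apply: xN; rewrite inE.
Qed.

(* [f] may fail to be measurable on the null set [D `\` D0]. *)
Lemma integral_null (D D0 : set X) (f : X -> \bar R) :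
  measurable D -> measurable D0 -> D0 `<=` D -> m (D `\` D0) = 0 ->
  \int[m]_(x in D) f x = \int[m]_(x in D0) f x.
Proof.
move=> mD mD0 D0D N0; have mN := measurableD mD mD0.
have E x : ~ (D `\` D0) x -> (f \_ D) x = (f \_ D0) x.
  move=> nx; rewrite !patchE; have [xD0|xD0] := pselect (D0 x).
    by rewrite !mem_set//; exact: D0D.
  by rewrite !memNset// => xD; apply: nx.
rewrite /integral -!/(nn _); congr (_ - _); apply/eqP; rewrite eq_le;
  apply/andP; split; apply: (nn_le mN N0) => x; rewrite ?funepos_ge0 ?funeneg_ge0//;
  by move=> nx; rewrite ?funeposE ?funenegE E.
Qed.

Lemma integral_null_Rintegral (D D0 : set X) (f : X -> R) (M : R) :
  measurable D -> measurable D0 -> D0 `<=` D -> m (D `\` D0) = 0 ->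
  m D < +oo -> measurable_fun D0 f -> (forall x, `|f x| <= M)%R ->
  \int[m]_(x in D) (f x)%:E = (\int[m]_(x in D0) f x)%:E.
Proof.
move=> mD mD0 D0D N0 fD mf fM; rewrite (integral_null _ mD mD0 D0D N0).
rewrite /Rintegral fineK//; apply: integrable_fin_num => //.
apply: (@bounded_integrable _ _ _ _ _ _ M) => //.
by apply: le_lt_trans fD; apply: le_measure => //; rewrite inE.
Qed.

End integral_null.

Section dynamics.
Context {R : realType} {d : measure_display} {X : measurableType d}.
Variables (mu : probability X R) (T : X -> X) (A : set X).
Hypotheses (mpT : measure_preserving mu T) (ergT : ergodic mu T).
Hypotheses (mA : measurable A) (A0 : (0 < mu A)%E).

Lemma measurable_iter n : measurable_fun setT (iter n T).
Proof.
elim: n => [|n IH]; first exact: measurable_id.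
by apply: measurableT_comp IH; have [] := mpT.
Qed.

Lemma measurable_iter_preimage n B : measurable B -> measurable (iter n T @^-1` B).
Proof. by move=> mB; rewrite -[X in measurable X]setTI; exact: measurable_iter. Qed.

Lemma measure_iter_preimage n B : measurable B -> mu (iter n T @^-1` B) = mu B.
Proof.
move=> mB; elim: n => //= n IH; rewrite -IH -[RHS](mpT.2 _ (measurable_iter_preimage n mB)).
by congr (mu _); apply/seteqP; split=> x; rewrite /preimage/= -iterS iterSr.
Qed.

(** Asking for infinitely many visits makes the set exactly invariant, as [ergodic] demands, and
    keeps all hitting times finite along the orbit of [TA]. *)
Definition recurrent : set X := lim_sup_set (fun n => iter n T @^-1` A).

Lemma recurrentP x : recurrent x <-> forall n, exists2 k, (n <= k)%N & A (iter k T x).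
Proof. by split=> [h n|h n _]; [have [k] := h n I|have [k] := h n]; exists k. Qed.

Lemma measurable_recurrent : measurable recurrent.
Proof.
apply: bigcapT_measurable => n; apply: bigcup_measurable => k _.
exact: measurable_iter_preimage.
Qed.

Lemma recurrent_T x : recurrent (T x) <-> recurrent x.
Proof.
rewrite !recurrentP; split=> h n.
  by have [k nk Ak] := h n; exists k.+1; [exact: leqW|rewrite iterSr].
have [[|k] nk Ak] := h n.+1 => //.
by exists k => //; rewrite -iterSr.
Qed.

Lemma recurrent_iter n x : recurrent x -> recurrent (iter n T x).
Proof. by move=> rx; elim: n => //= n; rewrite recurrent_T. Qed.

(** Ergodicity leaves the values 0 and 1. The measure is the limit of those of the tail unions, each
    of which contains a preimage of [A] and so has measure at least [mu A], which excludes 0. *)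
Lemma recurrent_full : mu recurrent = 1%E.
Proof.
have : mu recurrent = 0%E \/ mu recurrent = 1%E.
  apply: ergT; first exact: measurable_recurrent.
  by apply/seteqP; split=> x; rewrite /preimage/= recurrent_T.
case=> // r0.
have := @lim_sup_set_cvg _ _ _ mu (fun n => iter n T @^-1` A)
  (fun n => measurable_iter_preimage n mA).
rewrite ltey_eq fin_num_measure; last first.
  by apply: bigcup_measurable => k _; exact: measurable_iter_preimage.
move=> /(_ isT); rewrite -/recurrent => cv.
suff : (mu A <= mu recurrent)%E by rewrite r0 leNgt A0.
refine (cvge_to_ge cv _).
near=> n; rewrite -(measure_iter_preimage n mA); apply: le_measure; rewrite ?inE.
- exact: measurable_iter_preimage.
- by apply: bigcup_measurable => k _; exact: measurable_iter_preimage.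
- by move=> x Ax; exists n => /=.
Unshelve. all: by end_near. Qed.

Lemma recurrent_null : mu (setT `\` recurrent) = 0%E.
Proof.
by rewrite setTD probability_setC ?recurrent_full ?subee//; exact: measurable_recurrent.
Qed.

Lemma phiN_spec x : recurrent x -> [/\ (0 < phiN T A x)%N,
  A (TA T A x) & forall k, (0 < k)%N -> A (iter k T x) -> (phiN T A x <= k)%N].
Proof.
move=> /recurrentP/(_ 1%N)[k k0 Ak].
rewrite /TA /phiN; case: pselect => [h|[]]; last by exists k; apply/asboolP.
case: ex_minnP => n /asboolP[n0 An] nmin; split=> // j j0 Aj.
by apply: nmin; apply/asboolP.
Qed.

Lemma phiAE x : recurrent x -> phiA T A x = ((phiN T A x)%:R : R)%:E.
Proof.
move=> /phiN_spec[n0 An nmin]; apply/eqP; rewrite eq_le; apply/andP; split.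
  by apply: ereal_inf_lbound; exists (phiN T A x).
by apply: le_ereal_inf_tmp => _ [k [k0 Ak] <-]; rewrite lee_fin ler_nat nmin.
Qed.

Lemma recurrent_TA x : recurrent x -> recurrent (TA T A x).
Proof. exact: recurrent_iter. Qed.

Lemma recurrent_iter_TA k x : recurrent x -> recurrent (iter k (TA T A) x).
Proof. by move=> rx; elim: k => //= k; exact: recurrent_TA. Qed.

Lemma TA_hit x : recurrent x -> A (T x) -> phiN T A x = 1%N /\ TA T A x = T x.
Proof.
move=> rx AT; have [n0 _ /(_ 1%N isT AT) n1] := phiN_spec rx.
by rewrite /TA; have -> : phiN T A x = 1%N by apply/eqP; rewrite eqn_leq n1.
Qed.

Lemma TA_miss x : recurrent x -> ~ A (T x) ->
  phiN T A x = (phiN T A (T x)).+1 /\ TA T A x = TA T A (T x).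
Proof.
move=> rx AT; have rTx : recurrent (T x) by rewrite recurrent_T.
have [n0 An nmin] := phiN_spec rx; have [n0' An' nmin'] := phiN_spec rTx.
have e : phiN T A x = (phiN T A (T x)).+1.
  apply/eqP; rewrite eqn_leq; apply/andP; split.
    by apply: nmin => //; rewrite iterSr.
  move: n0 An; rewrite /TA; case: (phiN T A x) => [//|[//|n]] _ An.
  by rewrite ltnS; apply: nmin' => //; rewrite -iterSr.
by rewrite /TA e iterSr.
Qed.

End dynamics.

(** * The tower identity over the induced map *)

Section tower.
Context {R : realType} {d : measure_display} {X : measurableType d}.
Variables (mu : probability X R) (T : X -> X) (A : set X).
Hypotheses (mpT : measure_preserving mu T) (mA : measurable A).
Notation X0 := (recurrent T A).

Let mX0 : measurable X0. Proof. exact: measurable_recurrent mpT mA. Qed.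

Lemma measurable_phiN n : measurable (X0 `&` phiN T A @^-1` [set n]).
Proof.
rewrite (_ : _ `&` _ = X0 `&` ([set _ | (0 < n)%N] `&` iter n T @^-1` A `&`
    \bigcap_(k in [set k | (0 < k < n)%N]) ~` (iter k T @^-1` A))).
  apply: measurableI => //; apply: measurableI.
    apply: measurableI; last exact: measurable_iter_preimage mpT _ _ mA.
    by case: n => [|n]; [rewrite (_ : [set _ | _] = set0)|
      rewrite (_ : [set _ | _] = setT)] => //; apply/seteqP; split.
  apply: bigcap_measurableType => k _; apply: measurableC.
  exact: measurable_iter_preimage mpT _ _ mA.
apply/seteqP; split=> x [rx]; rewrite /preimage/=.
  have [n0 An nmin] := phiN_spec rx => xn; split => //.
  split; first by rewrite -xn; split.
  move=> k /= /andP[k0 kn] Ak; have := nmin k k0 Ak.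
  by rewrite xn leqNgt kn.
move=> [[n0 An] nmin]; split=> //.
have [m0 Am mmin] := phiN_spec rx.
apply/eqP; rewrite eqn_leq mmin//= leqNgt; apply/negP => mn.
by apply: (nmin (phiN T A x)) => //=; rewrite m0.
Qed.

Lemma measurable_fun_phiN d' (Y : measurableType d') (f : nat -> X -> Y) :
  (forall n, measurable_fun setT (f n)) ->
  measurable_fun X0 (fun x => f (phiN T A x) x).
Proof.
move=> mf _ B mB.
rewrite (_ : _ `&` _ = \bigcup_n ((X0 `&` phiN T A @^-1` [set n]) `&` f n @^-1` B)).
  apply: bigcupT_measurable => n; apply: measurableI; first exact: measurable_phiN.
  by rewrite -[X in measurable X]setTI; exact: mf.
apply/seteqP; split=> [x [rx Bx]|x [n _ [[rx /= <-] Bx]]//].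
by exists (phiN T A x).
Qed.

Lemma measurable_TA : measurable_fun X0 (TA T A).
Proof.
by apply: (measurable_fun_phiN (f := fun n => iter n T)) => n; exact: measurable_iter mpT n.
Qed.

Lemma measurable_phiA : measurable_fun X0 (phiA T A : X -> \bar R).
Proof.
apply: (@eq_measurable_fun _ _ _ _ _ (fun x => ((phiN T A x)%:R : R)%:E)).
  by move=> x; rewrite inE => rx; rewrite phiAE.
by apply: (@measurable_fun_phiN _ _ (fun n _ => ((n%:R : R)%:E))) => n;
  exact: measurable_cst.
Qed.

Lemma measurable_iter_TA k : measurable_fun X0 (iter k (TA T A)).
Proof.
elim: k => [|k IH]; first exact: measurable_id.
apply: (@measurable_comp _ _ _ _ _ _ X0) IH => //; last exact: measurable_TA.
by move=> _ [x rx <-]; exact: recurrent_iter_TA.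
Qed.

Lemma Rintegral_invariant (W : X -> R) (M : R) : measurable_fun setT W ->
  (forall x, `|W x| <= M) -> \int[mu]_x W (T x) = \int[mu]_x W x.
Proof.
move=> mW WM; have [mT muT] := mpT.
pose Tm : {mfun X >-> X} := HB.pack T (isMeasurableFun.Build _ _ _ _ _ mT).
rewrite /Rintegral; congr fine.
transitivity (\int[distribution mu Tm]_x (W x)%:E)%E; last first.
  by apply: eq_measure_integral => B mB _; exact: muT.
rewrite (@integral_distribution _ _ _ _ _ mu Tm (EFin \o W))//.
  exact/measurable_EFinP.
apply: (@bounded_integrable _ _ _ _ _ _ M) => //.
- by rewrite /= ltey_eq fin_num_measure.
- exact: measurableT_comp.
Qed.

(* [U (T x) - q^-1 * U x] vanishes unless [T x] lies in [A], where it equals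
   [U (T x) - f (T x)]; integrating this cocycle identity gives the claim. *)
Lemma tower_identity (f : X -> R) (M q : R) :
  measurable_fun (A `&` X0) f -> (forall x, `|f x| <= M) -> 0 < q <= 1 ->
  let U x := q ^+ phiN T A x * f (TA T A x) in
  (q^-1 - 1) * \int[mu]_(x in X0) U x =
  \int[mu]_(x in A `&` X0) f x - \int[mu]_(x in A `&` X0) U x.
Proof.
move=> mf fM /andP[q0 q1] U.
have mAX0 : measurable (A `&` X0) by exact: measurableI.
have mU : measurable_fun X0 U.
  apply: measurable_funM.
    by apply: (@measurable_fun_phiN _ _ (fun n _ => q ^+ n)) => n; exact: measurable_cst.
  apply: (@measurable_comp _ _ _ _ _ _ (A `&` X0)) measurable_TA => //.
  move=> _ [x rx <-]; split; last exact: recurrent_TA.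
  by have [] := phiN_spec rx.
have UM x : `|U x| <= M.
  rewrite normrM ger0_norm ?exprn_ge0 ?(ltW q0)//.
  by apply: le_trans (fM (TA T A x)); rewrite ler_piMl// exprn_ile1// ltW.
have M0 : 0 <= M by apply: le_trans (fM point).
have fin (D : set X) : measurable D -> (mu D < +oo)%E.
  by move=> mD; rewrite ltey_eq fin_num_measure.
pose W := U \_ X0; pose V := (fun x => U x - f x) \_ (A `&` X0).
have mUA : measurable_fun (A `&` X0) U.
  by apply: measurable_funS mU => // x [].
have mW : measurable_fun setT W.
  by apply/(measurable_restrict U mX0 measurableT); rewrite setTI.
have mV : measurable_fun setT V.
  apply/(measurable_restrict _ mAX0 measurableT); rewrite setTI.
  exact: measurable_funB.
have WM : forall x, `|W x| <= M.
  by move=> x; rewrite /W patchE; case: ifP => // _; rewrite normr0.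
have VM : forall x, `|V x| <= M + M.
  move=> x; rewrite /V patchE; case: ifP => // _; last by rewrite normr0 addr_ge0.
  by apply: le_trans (ler_normB _ _) _; exact: lerD.
(* Off the invariant set [X0] all terms vanish. If [T x] lies in [A], then [U x = q * f (T x)];
   otherwise the hitting time drops by one from [x] to [T x] and the hitting point stays the
   same. *)
have WV x : W (T x) = q^-1 * W x + V (T x).
  have [rx|nrx] := pselect (X0 x); last first.
    rewrite /W /V !patchE !memNset ?mulr0 ?addr0//; first by case=> _ /recurrent_T.
    by move/recurrent_T.
  rewrite /W /V !patchE !(mem_set rx) (mem_set ((recurrent_T _ _ _).2 rx)).
  have [AT|AT] := pselect (A (T x)).
    rewrite mem_set; last by split=> //; rewrite recurrent_T.
    have [e1 e2] := TA_hit rx AT.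
    by rewrite {2}/U e1 e2 expr1 mulKf ?gt_eqF// addrCA subrr addr0.
  rewrite memNset; last by case.
  have [e1 e2] := TA_miss rx AT.
  by rewrite /U e1 e2 exprS addr0 -mulrA mulKf ?gt_eqF.
have IW : mu.-integrable setT (EFin \o W).
  by apply: (@bounded_integrable _ _ _ _ _ _ M) => //; exact: fin.
(* Invariance of [mu], applied to [W] and to [V], turns the cocycle identity into [(q^-1 - 1)] times
   the integral of [W] being minus the integral of [V]. *)
have := Rintegral_invariant mW WM.
rewrite (eq_Rintegral mu (g := fun x => q^-1 * W x + V (T x))); last by move=> x _; exact: WV.
rewrite RintegralD//; last 2 first.
- apply: (@bounded_integrable _ _ _ _ _ _ (q^-1 * M)) => //; first exact: fin.
    exact: measurable_funM.
  by move=> x _; rewrite normrM ger0_norm ?invr_ge0 ?(ltW q0)// ler_pM// ?invr_ge0 ltW.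
- apply: (@bounded_integrable _ _ _ _ _ _ (M + M)) => //; first exact: fin.
  by apply: measurableT_comp => //; have [] := mpT.
rewrite RintegralZl// (Rintegral_invariant mV VM) /W /V -!Rintegral_mkcond.
rewrite RintegralB//; last 2 first.
- by apply: (@bounded_integrable _ _ _ _ _ _ M) => //; exact: fin.
- by apply: (@bounded_integrable _ _ _ _ _ _ M) => //; exact: fin.
lra.
Qed.

End tower.

Section path_maps.
Context {R : realType} {d : measure_display} {X : measurableType d}
  {F : pseudoMetricType R}.
Variables (mu : probability X R) (T : X -> X) (A : set X) (psi : X -> F) (y0 : F).
Hypotheses (mpT : measure_preserving mu T) (mA : measurable A).
Hypothesis mpsi : borel_meas_on A psi.
Notation X0 := (recurrent T A).

Let mX0 : measurable X0. Proof. exact: measurable_recurrent mpT mA. Qed.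

Lemma measurable_scaledPhiA k :
  measurable_fun X0 (fun x => scaledPhiA mu T A x k).
Proof.
apply: measurable_funeM.
apply: (@measurable_comp _ _ _ _ _ _ X0) (measurable_iter_TA mpT mA k) => //.
  by move=> _ [x rx <-]; exact: recurrent_iter_TA.
exact: measurable_phiA mpT mA.
Qed.

Lemma measurable_hitting_path : measurable_fun X0
  (fun x => (scaledPhiA mu T A x, PsiA T A psi x) : mpath y0).
Proof.
apply: measurable_path => // k; first exact: measurable_scaledPhiA.
move=> U oU.
(* [psi] is measurable on [A] only, but from the first iterate of [TA] on the orbit lies in [A]. *)
rewrite (_ : _ `&` _ = X0 `&` iter k.+1 (TA T A) @^-1` (A `&` psi @^-1` U)).
  by apply: (measurable_iter_TA mpT mA k.+1) => //; exact: mpsi.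
apply/seteqP; split=> x [rx]; last by move=> [].
move=> Ux; split=> //; split => //.
by have [] := phiN_spec (recurrent_iter_TA k rx).
Qed.

(** Here the mark of index 0 is read at the starting point itself, which therefore has to lie in
    [A]. *)
Lemma measurable_return_path : measurable_fun (A `&` X0)
  (fun x => (scaledPhiA mu T A x, PsitA T A psi x) : mpath y0).
Proof.
apply: measurable_path => [|k|k].
- exact: measurableI.
- by apply: measurable_funS (measurable_scaledPhiA k) => // x [].
move=> U oU.
rewrite (_ : _ `&` _ = A `&` (X0 `&` iter k (TA T A) @^-1` (A `&` psi @^-1` U))).
  apply: measurableI => //.
  by apply: (measurable_iter_TA mpT mA k) => //; exact: mpsi.
apply/seteqP; split=> x; last by move=> [Ax [rx []]].
move=> [[Ax rx] Ux]; split=> //; split=> //; split => //.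
case: k {Ux} => [//|k].
by have [] := phiN_spec (recurrent_iter_TA k rx).
Qed.

End path_maps.

(** * Hitting and return expectations *)

Lemma continuous_lincomb (S : topologicalType) (R : realType) (c : R)
    (f g : S -> R) :
  continuous f -> continuous g -> continuous (fun z => c * f z + g z).
Proof.
move=> cf cg z; apply: (@continuousD R R S); last exact: cg.
exact: (cvgM (cvg_cst c) (cf z)).
Qed.

(** * Bounded continuous functions on the path space *)

Section path_topology.
Context {R : realType} {F : pseudoMetricType R}.
Implicit Types g : path_space R F -> R.

Lemma path_continuous (S : topologicalType) (u : S -> path_space R F) :
  (forall k, continuous (fun s => (u s).1 k)) ->
  (forall k, continuous (fun s => (u s).2 k)) -> continuous u.
Proof. by move=> h1 h2 s; apply: ptws_pair_cvg => k; [exact: h1|exact: h2]. Qed.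

Lemma coord1_continuous k : continuous (fun z : path_space R F => z.1 k).
Proof.
move=> z.
have /pointwise_cvgP/(_ k) h : nbhs (z.1 : {ptws nat -> \bar R}) --> (z.1 : {ptws nat -> \bar R}).
  exact: cvg_id.
by apply: cvg_comp h; exact: cvg_fst.
Qed.

Lemma coord2_continuous k : continuous (fun z : path_space R F => z.2 k).
Proof.
move=> z.
have /pointwise_cvgP/(_ k) h : nbhs (z.2 : {ptws nat -> F}) --> (z.2 : {ptws nat -> F}).
  exact: cvg_id.
by apply: cvg_comp h; exact: cvg_snd.
Qed.

(** With [b] false, the hitting path of [x] becomes the return path of [TA x]; with [b] true, the
    return path of [x] does. *)
Definition path_shift (b : bool) (z : path_space R F) : path_space R F :=
  (fun k => z.1 k.+1, fun k => z.2 (b + k)%N).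

Definition damp b a g (z : path_space R F) : R :=
  dexp a (z.1 0%N) * g (path_shift b z).

Lemma path_shift_continuous b : continuous (path_shift b).
Proof.
by apply: path_continuous => k; [exact: coord1_continuous|exact: coord2_continuous].
Qed.

Lemma bcont_comp g (u : path_space R F -> path_space R F) :
  continuous u -> bcont g -> bcont (g \o u).
Proof.
move=> cu [cg [M gM]]; split; last by exists M => z; exact: gM.
by move=> z; apply: continuous_comp; [exact: cu|exact: cg].
Qed.

Lemma bcontD c g1 g2 : bcont g1 -> bcont g2 -> bcont (fun z => c * g1 z + g2 z).
Proof.
move=> [c1 [M1 b1]] [c2 [M2 b2]]; split.
  exact: continuous_lincomb.
exists (`|c| * M1 + M2) => z; apply: le_trans (ler_normD _ _) _.
by rewrite lerD// normrM ler_wpM2l.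
Qed.

Lemma bcontM g1 g2 : bcont g1 -> bcont g2 -> bcont (fun z => g1 z * g2 z).
Proof.
move=> [c1 [M1 b1]] [c2 [M2 b2]]; split.
  by move=> z; exact: (cvgM (c1 z) (c2 z)).
by exists (M1 * M2) => z; rewrite normrM ler_pM.
Qed.

Lemma bcont_cst c : bcont (fun _ : path_space R F => c).
Proof. by split; [move=> z; exact: cst_continuous|exists `|c|]. Qed.

Lemma bcont_dexp a : 0 < a -> bcont (fun z : path_space R F => dexp a (z.1 0%N)).
Proof.
move=> a0; split; last first.
  by exists 1 => z; rewrite ger0_norm ?dexp_ge0// dexp_le1// ltW.
move=> z; apply: (@continuous_comp _ _ _ (fun z : path_space R F => z.1 0%N) (dexp a)).
  exact: coord1_continuous.
exact: dexp_continuous.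
Qed.

Lemma bcont_damp b a g : 0 < a -> bcont g -> bcont (damp b a g).
Proof.
move=> a0 bg; apply: bcontM; first exact: bcont_dexp.
by apply: bcont_comp => //; exact: path_shift_continuous.
Qed.

(* Positivity is restricted to paths with a nonnegative first waiting time:
   these carry all the measures involved, and only there [nlog (dexp 1 s) = s]. *)
Definition state (J : (path_space R F -> R) -> R) :=
  [/\ forall c f g, bcont f -> bcont g ->
        J (fun z => c * f z + g z) = c * J f + J g,
      forall f g, bcont f -> bcont g ->
        (forall z, (0 <= z.1 0%N)%E -> f z <= g z) -> J f <= J g
    & J (fun=> 1) = 1].

End path_topology.

Section integral_state.
Context {R : realType} {F : pseudoMetricType R} {d : measure_display}
  {X : measurableType d}.
Hypothesis cF : compact [set: F].
Variables (m : {measure set X -> \bar R}) (y0 : F) (D D0 : set X)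
  (Z : X -> path_space R F) (c : R).
Hypotheses (mD : measurable D) (mD0 : measurable D0) (D0D : D0 `<=` D).
Hypotheses (N0 : m (D `\` D0) = 0%E) (c0 : 0 <= c)
  (cD : (c%:E * m D = 1)%E) (finD : (m D < +oo)%E).
Hypothesis mZ : measurable_fun D0 (Z : X -> mpath y0).
Hypothesis Z0 : forall x, D0 x -> (0 <= (Z x).1 0%N)%E.

Let finD0 : (m D0 < +oo)%E.
Proof. by apply: le_lt_trans finD; apply: le_measure => //; rewrite inE. Qed.

Let mgZ (g : path_space R F -> R) : bcont g -> measurable_fun D0 (g \o Z).
Proof.
move=> [cg _]; have mg : measurable_fun setT (g : mpath y0 -> R).
  exact: measurable_bcont.
exact: (@measurable_comp _ _ _ X (mpath y0) _ setT).
Qed.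

Let IgZ (g : path_space R F -> R) : bcont g ->
  m.-integrable D0 (EFin \o (fun x => g (Z x))).
Proof.
move=> bg; have [_ [M gM]] := bg.
by apply: (@bounded_integrable _ _ _ _ _ _ M) => //; exact: mgZ.
Qed.

Lemma integral_bcont (g : path_space R F -> R) : bcont g ->
  (\int[m]_(x in D) (g (Z x))%:E = (\int[m]_(x in D0) g (Z x))%:E)%E.
Proof.
move=> bg; have [_ [M gM]] := bg.
by apply: (@integral_null_Rintegral _ _ _ m D D0 (g \o Z) M) => //; [exact: (mgZ bg)|move=> x; exact: gM].
Qed.

(** One statement serves the hitting integral ([D] full, [c = 1]), the return integral ([D = A],
    [c = 1 / mu A]) and the limit law. All integrals reduce to [D0], where [Z] is measurable and its
    first waiting time nonnegative. *)
Lemma integral_state :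
  state (fun g => fine (c%:E * \int[m]_(x in D) (g (Z x))%:E)%E).
Proof.
have E g : bcont g -> fine (c%:E * \int[m]_(x in D) (g (Z x))%:E)%E =
    c * \int[m]_(x in D0) g (Z x).
  by move=> bg; rewrite integral_bcont.
split=> [k f g bf bg|f g bf bg fg|].
- rewrite (E _ (bcontD k bf bg)) (E _ bf) (E _ bg).
  rewrite RintegralD//; last 2 first.
  + by have := IgZ (bcontM (bcont_cst k) bf).
  + exact: IgZ.
  by rewrite RintegralZl//; [lra|exact: IgZ].
- rewrite !E// ler_wpM2l// le_Rintegral//; [exact: IgZ|exact: IgZ|].
  by move=> x Dx; apply: fg; exact: Z0.
- by rewrite integral_cst// mul1e cD.
Qed.

End integral_state.

Section return_identity.
Context {R : realType} {d : measure_display} {X : measurableType d}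
  {F : pseudoMetricType R}.
Variables (mu : probability X R) (T : X -> X) (A : set X) (psi : X -> F).
Hypotheses (mpT : measure_preserving mu T) (ergT : ergodic mu T).
Hypotheses (mA : measurable A) (A0 : (0 < mu A)%E).
Hypotheses (mpsi : borel_meas_on A psi) (cF : compact [set: F]).
Notation X0 := (recurrent T A).

(** The factor 1 brings the integral into the normalized form of [integral_state]. *)
Definition hitting_state (g : path_space R F -> R) : R :=
  fine (1%:E * \int[mu]_x (g (scaledPhiA mu T A x, PsiA T A psi x))%:E)%E.

Definition return_state (g : path_space R F -> R) : R :=
  fine (cond_int mu A (fun x => (g (scaledPhiA mu T A x, PsitA T A psi x))%:E)).

Let y0 : F := psi point.
Let muA : R := fine (mu A).
Let muAE : mu A = muA%:E. Proof. by rewrite /muA fineK// fin_num_measure. Qed.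
Let muA0 : 0 < muA. Proof. by rewrite -lte_fin -muAE. Qed.
Let mX0 : measurable X0. Proof. exact: measurable_recurrent mpT mA. Qed.

Let null : mu (A `\` (A `&` X0)) = 0%E.
Proof.
apply: (@subset_measure0 _ _ _ mu _ (setT `\` X0)).
- by apply: measurableD => //; exact: measurableI.
- exact: measurableD.
- by move=> x [Ax nAx]; split=> // rx; apply: nAx.
- exact: recurrent_null mpT ergT mA A0.
Qed.

Let scaledPhiA_ge0 x : X0 x -> (0 <= scaledPhiA mu T A x 0%N)%E.
Proof. by move=> rx; rewrite /scaledPhiA /PhiA mule_ge0//= phiAE// lee_fin. Qed.

Let hitting_int g : bcont g ->
  (\int[mu]_x (g (scaledPhiA mu T A x, PsiA T A psi x))%:E =
   (\int[mu]_(x in X0) g (scaledPhiA mu T A x, PsiA T A psi x))%:E)%E.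
Proof.
move=> bg; apply: (@integral_bcont R F _ X cF mu y0 setT X0
  (fun x => (scaledPhiA mu T A x, PsiA T A psi x))) => //.
- exact: recurrent_null mpT ergT mA A0.
- by rewrite ltey_eq fin_num_measure.
- exact: measurable_hitting_path mpT mA mpsi.
Qed.

Let return_int g : bcont g ->
  (\int[mu]_(x in A) (g (scaledPhiA mu T A x, PsitA T A psi x))%:E =
   (\int[mu]_(x in A `&` X0) g (scaledPhiA mu T A x, PsitA T A psi x))%:E)%E.
Proof.
move=> bg; apply: (@integral_bcont R F _ X cF mu y0 A (A `&` X0)
  (fun x => (scaledPhiA mu T A x, PsitA T A psi x))) => //.
- exact: measurableI.
- by rewrite ltey_eq fin_num_measure.
- exact: measurable_return_path mpT mA mpsi.
Qed.

Lemma hitting_stateE g : bcont g ->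
  (\int[mu]_x (g (scaledPhiA mu T A x, PsiA T A psi x))%:E)%E = (hitting_state g)%:E.
Proof. by move=> bg; rewrite /hitting_state hitting_int// mul1e. Qed.

Lemma return_stateE g : bcont g ->
  cond_int mu A (fun x => (g (scaledPhiA mu T A x, PsitA T A psi x))%:E) =
  (return_state g)%:E.
Proof. by move=> bg; rewrite /return_state /cond_int return_int. Qed.

Lemma hitting_state_state : state hitting_state.
Proof.
apply: (@integral_state R F _ X cF mu y0 setT X0
  (fun x => (scaledPhiA mu T A x, PsiA T A psi x)) 1) => //.
- exact: recurrent_null mpT ergT mA A0.
- by rewrite mul1e; exact: (probability_setT mu).
- by rewrite ltey_eq fin_num_measure.
- exact: measurable_hitting_path mpT mA mpsi.
Qed.

Lemma return_state_state : state return_state.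
Proof.
apply: (@integral_state R F _ X cF mu y0 A (A `&` X0)
  (fun x => (scaledPhiA mu T A x, PsitA T A psi x)) muA^-1) => //.
- exact: measurableI.
- by rewrite invr_ge0 ltW.
- have -> : (mu : {measure set X -> \bar R}) A = muA%:E by exact: muAE.
  by rewrite -EFinM mulVf// gt_eqF.
- by rewrite ltey_eq fin_num_measure.
- exact: measurable_return_path mpT mA mpsi.
- by move=> x [_ rx]; exact: scaledPhiA_ge0.
Qed.

(** The tower identity for [f] equal to [g] along the return path and [q = exp (- a mu A)], divided
    by [mu A]; then [q ^ phi_A] is the damping factor of the scaled hitting time. *)
Lemma hitting_return_identity a g : 0 < a -> bcont g ->
  (expR (a * fine (mu A)) - 1) / fine (mu A) * hitting_state (damp false a g) =
  return_state g - return_state (damp true a g).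
Proof.
move=> a0 bg; have [_ [M gM]] := bg.
rewrite -/muA /hitting_state /return_state /cond_int hitting_int; last exact: bcont_damp.
rewrite !return_int//; last exact: bcont_damp.
rewrite mul1e /= -/muA -mulrBr.
pose q := expR (- (a * muA)).
have q01 : 0 < q <= 1.
  by rewrite expR_gt0/= -expR0 ler_expR oppr_le0 mulr_ge0// ltW.
pose f x := g (scaledPhiA mu T A x, PsitA T A psi x).
have mf : measurable_fun (A `&` X0) f.
  apply: (@measurable_comp _ _ _ X (mpath y0) _ setT) => //.
    by apply: (@measurable_bcont _ _ cF); have [] := bg.
  exact: measurable_return_path mpT mA mpsi.
have dexpE x : X0 x -> dexp a (scaledPhiA mu T A x 0%N) = q ^+ phiN T A x.
  move=> rx; rewrite /scaledPhiA /PhiA/= phiAE// muAE -EFinM /=.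
  rewrite max_l; last by rewrite mulr_ge0// ltW.
  by rewrite -expRM_natl; congr expR; ring.
have phiS x : (fun k => scaledPhiA mu T A x k.+1) = scaledPhiA mu T A (TA T A x).
  by apply/funext => k; rewrite /scaledPhiA /PhiA iterSr.
have := @tower_identity _ _ _ mu T A mpT mA f M q mf (fun x => gM _) q01.
rewrite /= -expRN opprK.
(* [f (TA x)] is [g] at the hitting path of [x] with only the times shifted; on [A] it is also [g]
   at the return path of [x] with both sequences shifted. *)
rewrite (eq_Rintegral mu (D := X0)
  (g := fun x => damp false a g (scaledPhiA mu T A x, PsiA T A psi x))); last first.
  move=> x; rewrite inE => rx; rewrite /damp /= dexpE// /path_shift/= phiS /f.
  by congr (_ * g (_, _)); apply/funext => k; rewrite /PsiA /PsitA iterSr.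
rewrite (eq_Rintegral mu (D := A `&` X0) (f := fun x => q ^+ _ * _)
  (g := fun x => damp true a g (scaledPhiA mu T A x, PsitA T A psi x))); last first.
  move=> x; rewrite inE => -[_ rx]; rewrite /damp /= dexpE// /path_shift/= phiS /f.
  by congr (_ * g (_, _)); apply/funext => k; rewrite /PsitA -iterSr.
by move=> <-; ring.
Qed.

End return_identity.

(** * Bernstein approximation in the first waiting time *)

Section bernstein.
Context {R : realType}.
Implicit Types (u : R) (f : nat -> R).

(* De Casteljau recursion for the Bernstein operator
   [\sum_(i <= n) 'C(n, i) u^i (1 - u)^(n - i) f i]. *)
Fixpoint bern n u f : R :=
  if n is n'.+1 then (1 - u) * bern n' u f + u * bern n' u (fun i => f i.+1)
  else f 0%N.

Lemma bern_le n u f g : 0 <= u <= 1 -> (forall i, (i <= n)%N -> f i <= g i) ->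
  bern n u f <= bern n u g.
Proof.
move=> /andP[u0 u1]; elim: n f g => [|n IH] f g fg /=; first exact: fg.
by apply: lerD; apply: ler_wpM2l; rewrite ?subr_ge0//; apply: IH => i i_n;
  apply: fg => //; exact: leqW.
Qed.

(** The first two moments of the binomial law with parameters [n] and [u]. *)
Lemma bern_quadratic n u (a b c : R) :
  bern n u (fun i => a + b * i%:R + c * i%:R ^+ 2) =
  a + b * (n%:R * u) + c * (n%:R * u * (1 - u) + (n%:R * u) ^+ 2).
Proof.
elim: n a b c => [|n IH] a b c /=; first by ring.
rewrite IH.
rewrite (_ : (fun i : nat => _) =
  (fun i => (a + b + c) + (b + 2 * c) * i%:R + c * i%:R ^+ 2)); last first.
  by apply/funext => i; rewrite -natr1; ring.
by rewrite IH -natr1; ring.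
Qed.

(** The operator is positive, and by the binomial variance the quadratic error averages to
    [K u (1 - u) / n]. *)
Lemma bern_approx n u f (y e K : R) : (0 < n)%N -> 0 <= u <= 1 -> 0 <= K ->
  (forall i, (i <= n)%N -> `|f i - y| <= e + K * (i%:R / n%:R - u) ^+ 2) ->
  `|bern n u f - y| <= e + K / n%:R.
Proof.
move=> n0 u01 K0 h; have n0' : 0 < n%:R :> R by rewrite ltr0n.
have nn0 : n%:R != 0 :> R by rewrite gt_eqF.
(* The values 1 and -1 of [s] give the upper and the lower barrier for [f]. *)
have quad (s : R) : bern n u (fun i => y + s * (e + K * (i%:R / n%:R - u) ^+ 2)) =
    y + s * (e + K * (u * (1 - u)) / n%:R).
  rewrite (_ : (fun i : nat => _) = (fun i => (y + s * (e + K * u ^+ 2)) +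
    (- (s * K * 2 * u / n%:R)) * i%:R + (s * K / n%:R ^+ 2) * i%:R ^+ 2)).
    by rewrite bern_quadratic; field.
  by apply/funext => i; field.
have hu : K * (u * (1 - u)) / n%:R <= K / n%:R.
  rewrite ler_pM2r ?invr_gt0// -[leRHS]mulr1 ler_wpM2l//.
  by case/andP: u01 => ? ?; nra.
have up : bern n u f <= y + 1 * (e + K * (u * (1 - u)) / n%:R).
  rewrite -quad; apply: bern_le => // i i_n; have := h i i_n.
  by rewrite ler_norml => /andP[]; lra.
have lo : y + (-1) * (e + K * (u * (1 - u)) / n%:R) <= bern n u f.
  rewrite -quad; apply: bern_le => // i i_n; have := h i i_n.
  by rewrite ler_norml => /andP[]; lra.
by rewrite ler_norml; apply/andP; split; lra.
Qed.

End bernstein.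

Section time_change.
Context {R : realType}.

(** Inverse of [dexp 1] on [[0, +oo]], extended by [+oo] to a continuous map on the whole line. *)
Definition nlog (u : R) : \bar R := if u <= 0 then +oo%E else (- ln u)%:E.

Lemma nlogK (s : \bar R) : (0 <= s)%E -> nlog (dexp 1 s) = s.
Proof.
case: s => [r||] //=; last by rewrite /nlog lexx.
rewrite lee_fin => r0; rewrite /nlog leNgt expR_gt0/= expRK max_l// mul1r opprK//.
Qed.

Lemma nlog_le0 u : u <= 0 -> nlog u = +oo%E.
Proof. by rewrite /nlog => ->. Qed.

Lemma nlog_gt0 u : 0 < u -> nlog u = (- ln u)%:E.
Proof. by rewrite /nlog leNgt => ->. Qed.

Lemma nlog_continuous : continuous nlog.
Proof.
move=> u; rewrite /continuous_at; have [u0|u0|->] := ltgtP u 0.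
- rewrite (nlog_le0 (ltW u0)) => U Uy.
  suff hU : \forall v \near u, U (nlog v) by exact: hU.
  near=> v.
  have v0 : v < 0 by near: v; exact: lt_nbhsl.
  by rewrite (nlog_le0 (ltW v0)); exact: nbhs_singleton.
- rewrite (nlog_gt0 u0) => U Uu.
  have : (- ln v)%:E @[v --> u] --> (- ln u)%:E.
    by apply: cvg_EFin; [exact: nearW|apply: cvgN; exact: continuous_ln].
  move=> /(_ U Uu) h.
  suff hU : \forall v \near u, U (nlog v) by exact: hU.
  near=> v.
  have v0 : 0 < v by near: v; exact: lt_nbhsr.
  by rewrite (nlog_gt0 v0); near: v; exact: h.
- rewrite (nlog_le0 (lexx 0)) => U /nbhs_ereal_pinfty[Uy [M [_ MU]]].
  have e0 : 0 < expR (- M) :> R by exact: expR_gt0.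
  suff hU : \forall v \near 0, U (nlog v) by exact: hU.
  near=> v.
  have [v0|v0] := leP v 0; first by rewrite nlog_le0.
  rewrite nlog_gt0//; apply: MU; rewrite ltrNr -ltr_expR lnK ?posrE//.
  by near: v; exact: lt_nbhsl.
Unshelve. all: by end_near. Qed.

(** Monomials in [dexp 1 s] are thus damping factors of integer rate. For [j = 0] the two sides
    differ at [+oo]. *)
Lemma dexp1X (s : \bar R) j : (0 < j)%N -> dexp 1 s ^+ j = dexp j%:R s.
Proof.
move=> j0; case: s => [r||] /=; rewrite ?expr1n ?expr0n ?(gtn_eqF j0)//.
by rewrite -expRM_natl mulrN mul1r.
Qed.

End time_change.

Section modulus.
Context {R : realType} {F : pseudoMetricType R}.
Hypothesis cF : compact [set: F].

Definition path_cons (s : \bar R) (z : path_space R F) : path_space R F :=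
  (fun k => if k is k'.+1 then z.1 k' else s, z.2).

Lemma path_consK (z : path_space R F) : path_cons (z.1 0%N) (path_shift false z) = z.
Proof. by case: z => z1 z2; congr pair; apply/funext => -[]. Qed.

Lemma path_cons_continuous :
  continuous (fun p : R * path_space R F => path_cons (nlog p.1) p.2).
Proof.
apply: path_continuous => [[|k]|k] p /=.
- by apply: (@continuous_comp _ _ _ fst nlog); [exact: cvg_fst|exact: nlog_continuous].
- apply: (@continuous_comp _ _ _ snd (fun z : path_space R F => z.1 k)).
    exact: cvg_snd.
  exact: coord1_continuous.
- apply: (@continuous_comp _ _ _ snd (fun z : path_space R F => z.2 k)).
    exact: cvg_snd.
  exact: coord2_continuous.
Qed.

Lemma bcont_cons (g : path_space R F -> R) u : bcont g ->
  bcont (fun z => g (path_cons (nlog u) z)).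
Proof.
apply: bcont_comp; apply: path_continuous => [[|k]|k] /=.
- by move=> z; exact: cst_continuous.
- exact: coord1_continuous.
- exact: coord2_continuous.
Qed.

Lemma path_compact : compact [set: path_space R F].
Proof.
rewrite -setXTT; apply: compact_setX.
  have := @tychonoff nat (fun=> \bar R) (fun=> setT) (fun=> ereal_compact).
  by congr compact; apply/seteqP; split.
have := @tychonoff nat (fun=> F) (fun=> setT) (fun=> cF).
by congr compact; apply/seteqP; split.
Qed.

(** Compactness of [[0, 1]] times the path space, in near-covering form along radii tending to 0,
    makes the modulus in the first coordinate uniform in [z]. *)
Lemma uniform_modulus (g : path_space R F -> R) (e : R) : continuous g -> 0 < e ->
  exists2 r : R, 0 < r & forall u v z, 0 <= u <= 1 -> `|u - v| < r ->
    `|g (path_cons (nlog u) z) - g (path_cons (nlog v) z)| < e.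
Proof.
move=> cg e0.
pose G (p : R * path_space R F) := g (path_cons (nlog p.1) p.2).
have cG : continuous G.
  by move=> p; apply: continuous_comp; [exact: path_cons_continuous|exact: cg].
have cK : compact (`[0, 1]%classic `*` [set: path_space R F] :
    set (R * path_space R F)).
  by apply: compact_setX; [exact: segment_compact|exact: path_compact].
have := (compact_near_coveringP _).1 cK R 0^'+
  (fun r p => forall v, `|p.1 - v| < r -> `|G p - G (v, p.2)| < e) _.
case=> [[u z] _|r r0 h].
  have e2 : 0 < e / 2 by rewrite divr_gt0.
  have /cvgr_dist_lt/(_ _ e2) := cG (u, z).
  case=> -[/= V W] [/nbhs_ballP[s /= s0 sV] Wz] VW.
  have s2 : 0 < s / 2 by rewrite divr_gt0.
  exists (ball u (s / 2) `*` W, [set r | r < s / 2]) => /=.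
    split; last exact: nbhs_right_lt.
    by exists (ball u (s / 2), W) => //=; split=> //; exact: nbhsx_ballx.
  move=> [[u' z'] r] /= [[uu' Wz'] rs] v uv.
  have h1 : `|G (u, z) - G (u', z')| < e / 2.
    apply: VW; split => //=; apply: sV; apply: le_ball uu'.
    by rewrite ler_pdivrMr// ler_pMr// ler1n.
  have h2 : `|G (u, z) - G (v, z')| < e / 2.
    apply: VW; split => //=; apply: sV; rewrite [s]splitr.
    by apply: ball_triangle uu' _; exact: lt_trans uv rs.
  rewrite distrC in h1.
  rewrite [e]splitr; apply: le_lt_trans (ltrD h1 h2).
  exact: ler_distD.
have [t /= t0 th] : exists2 t : R, 0 < t & t < r.
  by exists (r / 2); [rewrite divr_gt0|rewrite ltr_pdivrMr// ltr_pMr// ltr1n].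
exists t => // u v z u01 uv.
have := h t; rewrite /= sub0r normrN gtr0_norm// => /(_ th t0) /(_ (u, z)).
by apply => //; split => //; rewrite /= in_itv.
Qed.

End modulus.

(** * Passage to the limit *)

Lemma bcont_bound {R : realType} {F : pseudoMetricType R}
    (g : path_space R F -> R) :
  bcont g -> exists2 M : R, 0 <= M & forall z, `|g z| <= M.
Proof.
move=> [_ [M gM]]; exists `|M| => // z.
by apply: le_trans (gM z) _; exact: ler_norm.
Qed.

Section state_lemmas.
Context {R : realType} {F : pseudoMetricType R}.
Variable J : (path_space R F -> R) -> R.
Hypothesis sJ : state J.
Implicit Types f g w : path_space R F -> R.

Lemma stateZ c f : bcont f -> J (fun z => c * f z) = c * J f.
Proof.
move=> bf; have [lin _ _] := sJ.
have J0 : J (fun=> 0) = 0.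
  have := lin 1 _ _ (bcont_cst 0) (bcont_cst 0).
  rewrite (_ : (fun z : path_space R F => _) = fun=> 0); last first.
    by apply/funext => z; rewrite mulr0 addr0.
  lra.
have := lin c _ _ bf (bcont_cst 0); rewrite J0 addr0 => <-.
by congr J; apply/funext => z; rewrite addr0.
Qed.

Lemma state_cst c : J (fun=> c) = c.
Proof.
have [_ _ J1] := sJ; have := stateZ c (bcont_cst 1); rewrite J1 mulr1 => e.
by rewrite -[RHS]e; congr J; apply/funext => z; rewrite mulr1.
Qed.

Lemma state_dist f g w : bcont f -> bcont g -> bcont w ->
  (forall z, (0 <= z.1 0%N)%E -> `|f z - g z| <= w z) -> `|J f - J g| <= J w.
Proof.
move=> bf bg bw h; have [lin mono _] := sJ.
have h1 : J f <= 1 * J w + J g.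
  rewrite -lin//; apply: mono => //; first exact: bcontD.
  by move=> z /h; rewrite ler_norml => /andP[]; lra.
have h2 : J g <= 1 * J w + J f.
  rewrite -lin//; apply: mono => //; first exact: bcontD.
  by move=> z /h; rewrite ler_norml => /andP[]; lra.
by rewrite ler_norml; apply/andP; split; lra.
Qed.

Lemma state_bound f (M : R) : bcont f -> (forall z, `|f z| <= M) -> `|J f| <= M.
Proof.
move=> bf fM; rewrite -[J f]subr0 -[X in _ - X](state_cst 0) -[leRHS](state_cst M).
apply: state_dist => //; [exact: bcont_cst|exact: bcont_cst|].
by move=> z _; rewrite subr0.
Qed.

Lemma state_damp_bound b (a : R) g (M : R) : 0 < a -> bcont g -> (forall z, `|g z| <= M) ->
  `|J (damp b a g)| <= M * J (damp b a (fun=> 1)).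
Proof.
move=> a0 bg gM; rewrite -stateZ; last by apply: bcont_damp => //; exact: bcont_cst.
rewrite -[J _]subr0 -[X in _ - X](state_cst 0).
have bd := bcont_damp b a0 bg; have bd1 := bcont_damp b a0 (bcont_cst (F := F) 1).
apply: state_dist => //; [exact: bcont_cst|exact: bcontM (bcont_cst M) bd1|].
move=> z _; rewrite subr0 /damp mulr1 normrM ger0_norm ?dexp_ge0// mulrC.
by rewrite ler_wpM2r ?dexp_ge0.
Qed.

End state_lemmas.

(** The quotient lies between [a] and [a * expR (a * m n)], by [1 + x <= expR x] at [x = a * m n]
    and at [x = - (a * m n)]. *)
Lemma cvg_expR_quotient {R : realType} (m : nat -> R) (a : R) : 0 < a ->
  (forall n, 0 < m n) -> m @ \oo --> 0 ->
  (expR (a * m n) - 1) / m n @[n --> \oo] --> a.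
Proof.
move=> a0 m0 cm.
apply: (@squeeze_cvgr _ _ _ _ (fun=> a) (fun n => a * expR (a * m n))).
- apply: nearW => n; apply/andP; split.
    by rewrite ler_pdivlMr// lerBrDl expR_ge1Dx.
  rewrite ler_pdivrMr//.
  have := expR_ge1Dx (- (a * m n)); have e0 := expR_gt0 (a * m n).
  move=> /(ler_wpM2l (ltW e0)); rewrite -expRD subrr expR0.
  by rewrite mulrDr mulr1 mulrN; lra.
- exact: cvg_cst.
- rewrite -[X in _ --> X]mulr1; apply: cvgM; first exact: cvg_cst.
  rewrite -expR0; apply: continuous_cvg; first exact: continuous_expR.
  by rewrite -(mulr0 a); apply: cvgM; first exact: cvg_cst.
Qed.

Section limits.
Context {R : realType} {F : pseudoMetricType R}.
Hypothesis cF : compact [set: F].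
Variables (J Jt : nat -> (path_space R F -> R) -> R)
  (Ji : (path_space R F -> R) -> R) (c : R -> nat -> R).
Hypotheses (sJ : forall n, state (J n)) (sJt : forall n, state (Jt n))
  (sJi : state Ji).
Hypothesis c_gt0 : forall a n, 0 < a -> 0 < c a n.
Hypothesis c_cvg : forall a, 0 < a -> c a n @[n --> \oo] --> a.
Hypothesis cE : forall a g n, 0 < a -> bcont g ->
  c a n * J n (damp false a g) = Jt n g - Jt n (damp true a g).
Hypothesis JiE : forall b a g, 0 < a -> bcont g ->
  Ji (damp b a g) = (1 + a)^-1 * Ji g.
Implicit Types g : path_space R F -> R.

Lemma hitting_to_return :
  (forall g, bcont g -> J n g @[n --> \oo] --> Ji g) ->
  forall g, bcont g -> Jt n g @[n --> \oo] --> Ji g.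
Proof.
move=> cJ g bg; have [M M0 gM] := bcont_bound bg.
apply/cvgrPdist_lt => e e0.
(* Large enough for [M / (1 + a) < e / 4], since [e / 4 * (1 + a) = M + e / 2]. *)
pose a : R := 4 * M / e + 1.
have a0 : 0 < a by rewrite ltr_wpDl// divr_ge0 ?(ltW e0)// mulr_ge0.
have a1 : 0 < 1 + a by rewrite addr_gt0.
have Me : M / (1 + a) < e / 4.
  rewrite ltr_pdivrMr// (_ : _ * _ = M + e / 2); first by lra.
  by rewrite /a; field; rewrite gt_eqF.
have b1 := bcont_cst (F := F) (1 : R).
have lim1 f : bcont f ->
    c a n * J n (damp false a f) @[n --> \oo] --> a * ((1 + a)^-1 * Ji f).
  move=> bf; rewrite -(JiE false a0 bf); apply: cvgM; first exact: c_cvg.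
  by apply: cJ; exact: bcont_damp.
have lg := lim1 _ bg; have l1 := lim1 _ b1.
have e4 : 0 < e / 4 by rewrite divr_gt0.
have JiM : `|Ji g| <= M by exact: state_bound.
have M4 : 0 < M + 1 by rewrite ltr_wpDl.
have e41 : 0 < e / 4 / (M + 1) by rewrite divr_gt0.
have aE : a * (1 + a)^-1 = 1 - (1 + a)^-1 by field; rewrite gt_eqF.
near=> n.
have hg : `|a * ((1 + a)^-1 * Ji g) - c a n * J n (damp false a g)| < e / 4.
  by near: n; exact: cvgr_dist_lt lg _ e4.
have h1 : `|a * ((1 + a)^-1 * Ji (fun=> 1)) - c a n * J n (damp false a (fun=> 1))|
    < e / 4 / (M + 1).
  by near: n; exact: cvgr_dist_lt l1 _ e41.
(* For [g = 1] the identity shows that the damped return expectation of 1 is near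
   [1 - a / (1 + a) = (1 + a)^-1]. *)
have jt1 := cE n a0 b1; rewrite (state_cst (sJt n)) in jt1.
rewrite (state_cst sJi) jt1 mulr1 aE in h1.
have jt := cE n a0 bg; rewrite jt mulrA aE in hg.
have hb := state_damp_bound (sJt n) true a0 bg gM.
have h2 : M * Jt n (damp true a (fun=> 1)) < e / 4 + e / 4.
  have : Jt n (damp true a (fun=> 1)) < (1 + a)^-1 + e / 4 / (M + 1).
    by move: h1; rewrite ltr_norml => /andP[]; lra.
  move=> /ltW/(ler_wpM2l M0)/le_lt_trans; apply; rewrite mulrDr.
  apply: ltr_leD => //.
  rewrite mulrCA ger_pMr// ler_pdivrMr// mul1r; lra.
have h3 : `|(1 + a)^-1 * Ji g| < e / 4.
  apply: le_lt_trans Me; rewrite normrM ger0_norm ?invr_ge0 ?(ltW a1)// mulrC.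
  by rewrite ler_wpM2r// invr_ge0 ltW.
(* Error budget: [e / 4] from the identity, [e / 2] from the damped return term, [e / 4] from the
   damped limit term. *)
move: hg hb h2 h3; rewrite mulrBl mul1r !ltr_norml ler_norml => /andP[? ?] /andP[? ?] ? /andP[? ?].
by apply/andP; split; lra.
Unshelve. all: by end_near. Qed.

Section return_to_hitting.
Hypothesis cJt : forall g, bcont g -> Jt n g @[n --> \oo] --> Ji g.

Let conv g := J n g @[n --> \oo] --> Ji g.

Let conv_lin k f g : bcont f -> bcont g -> conv f -> conv g ->
  conv (fun z => k * f z + g z).
Proof.
move=> bf bg cf cg; have [lin _ _] := sJi.
rewrite /conv lin//; under eq_fun => n do [have [linn _ _] := sJ n; rewrite linn//].
by apply: cvgD cg; apply: cvgM cf; exact: cvg_cst.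
Qed.

Let conv_cst k : conv (fun=> k).
Proof.
rewrite /conv (state_cst sJi); under eq_fun => n do rewrite (state_cst (sJ n)).
exact: cvg_cst.
Qed.

(** The majorant [w] also converges, so [J n w] is eventually as small as [Ji w] up to [e / 4]; this
    controls the replacement of [g] by [f] under every [J n]. *)
Let conv_approx g : bcont g -> (forall e, 0 < e -> exists f w,
    [/\ bcont f /\ bcont w, conv f, conv w,
        forall z, (0 <= z.1 0%N)%E -> `|g z - f z| <= w z & Ji w <= e]) ->
  conv g.
Proof.
move=> bg h; apply/cvgrPdist_lt => e e0.
have e4 : 0 < e / 4 by rewrite divr_gt0.
have [f [w [[bf bw] cf cw gfw we]]] := h _ e4.
near=> n.
have hf : `|Ji f - J n f| < e / 4 by near: n; exact: cvgr_dist_lt cf _ e4.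
have hw : `|Ji w - J n w| < e / 4 by near: n; exact: cvgr_dist_lt cw _ e4.
have h1 := state_dist sJi bg bf bw gfw.
have h2 := state_dist (sJ n) bg bf bw gfw.
move: hf hw h1 h2; rewrite !ltr_norml !ler_norml.
move=> /andP[? ?] /andP[? ?] /andP[? ?] /andP[? ?].
by apply/andP; split; lra.
Unshelve. all: by end_near. Qed.

(** The identity is solved for the hitting term by dividing by [c a n], which is positive and tends
    to [a]. *)
Let conv_damp (a : R) g : 0 < a -> bcont g -> conv (damp false a g).
Proof.
move=> a0 bg; have a1 : 0 < 1 + a by rewrite addr_gt0.
rewrite /conv JiE//.
have -> : (1 + a)^-1 * Ji g = (Ji g - (1 + a)^-1 * Ji g) / a.
  by field; rewrite !gt_eqF.
have E n : J n (damp false a g) = (Jt n g - Jt n (damp true a g)) / c a n.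
  by rewrite -cE// mulrC mulKf// gt_eqF// c_gt0.
under eq_fun do rewrite E.
apply: cvgM; last by apply: cvgV; [rewrite gt_eqF|exact: c_cvg].
apply: cvgB; first exact: cJt.
by rewrite -(JiE true a0 bg); apply: cJt; exact: bcont_damp.
Qed.

(** Removing the damping costs at most [M * (1 - exp (- a Phi_0))]. This majorant converges by
    [conv_damp], and its limit [M * a / (1 + a)] is small with [a]. *)
Let conv_shift g : bcont g -> conv (g \o path_shift false).
Proof.
move=> bg; have [M M0 gM] := bcont_bound bg.
have b1 := bcont_cst (F := F) (1 : R).
apply: conv_approx.
  by apply: bcont_comp bg; exact: path_shift_continuous.
move=> e e0; pose a : R := e / (M + 1).
have M1 : 0 < M + 1 by rewrite ltr_wpDl.
have a0 : 0 < a by rewrite divr_gt0.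
have a1 : 0 < 1 + a by rewrite addr_gt0.
have bd := bcont_damp false a0 b1.
exists (damp false a g), (fun z => - M * damp false a (fun=> 1) z + M); split.
- by split; [exact: bcont_damp|apply: bcontD => //; exact: bcont_cst].
- exact: conv_damp.
- apply: conv_lin => //; [exact: bcont_cst|exact: conv_damp].
- move=> z _; rewrite /damp mulr1 /=.
  rewrite -[X in `|X - _|]mul1r -mulrBl normrM.
  rewrite ger0_norm ?subr_ge0 ?dexp_le1 ?(ltW a0)//.
  rewrite (_ : - M * _ + M = (1 - dexp a (z.1 0%N)) * M); last by ring.
  by apply: ler_wpM2l => //; rewrite subr_ge0 dexp_le1// ltW.
have [lin _ _] := sJi; rewrite lin//; last exact: bcont_cst.
rewrite JiE// !(state_cst sJi) mulr1.
have -> : - M * (1 + a)^-1 + M = (a / (1 + a)) * M by field; rewrite gt_eqF.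
have h1 : a / (1 + a) <= a.
  by rewrite ler_pdivrMr// ler_pMr// lerDl ltW.
apply: le_trans (ler_wpM2r M0 h1) _.
by rewrite /a mulrAC ler_pdivrMr// ler_wpM2l ?(ltW e0)// lerDl.
Qed.

Let u_ (z : path_space R F) : R := dexp 1 (z.1 0%N).

Let bcont_u j : bcont (fun z => u_ z ^+ j).
Proof.
elim: j => [|j IH].
  rewrite (_ : (fun z => _) = fun=> 1); first exact: bcont_cst.
  by apply/funext => z; rewrite expr0.
rewrite (_ : (fun z => _) = fun z => u_ z * u_ z ^+ j); last first.
  by apply/funext => z; rewrite exprS.
by apply: bcontM => //; exact: bcont_dexp.
Qed.

(** Induction along the De Casteljau recursion; the extra power [j] absorbs the factors [u] it
    produces. At the base the function is undamped for [j = 0] and damped at rate [j] otherwise. *)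
Let conv_bern n j (G : nat -> path_space R F -> R) : (forall i, bcont (G i)) ->
  let f z := u_ z ^+ j * bern n (u_ z) (fun i => G i (path_shift false z)) in
  bcont f /\ conv f.
Proof.
elim: n j G => [|n IH] j G bG /=.
  have bGs : bcont (G 0%N \o path_shift false).
    by apply: bcont_comp (bG 0%N); exact: path_shift_continuous.
  split; first exact: bcontM.
  case: j => [|j].
    rewrite (_ : (fun z => _) = G 0%N \o path_shift false); first exact: conv_shift.
    by apply/funext => z; rewrite expr0 mul1r.
  rewrite (_ : (fun z => _) = damp false j.+1%:R (G 0%N)); first exact: conv_damp.
  by apply/funext => z; rewrite /u_ dexp1X.
have [b1 c1] := IH j G bG; have [b2 c2] := IH j.+1 G bG.
have [b3 c3] := IH j.+1 (fun i => G i.+1) (fun i => bG i.+1).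
set f := fun z => _; set f1 := fun z => _ in b1 c1.
set f2 := fun z => _ in b2 c2; set f3 := fun z => _ in b3 c3.
have -> : f = fun z => -1 * f2 z + (1 * f3 z + f1 z).
  by apply/funext => z; rewrite /f /f1 /f2 /f3 exprS; ring.
by split; [apply: bcontD => //; exact: bcontD|apply: conv_lin => //;
  [exact: bcontD|exact: conv_lin]].
Qed.

Lemma return_to_hitting g : bcont g -> J n g @[n --> \oo] --> Ji g.
Proof.
move=> bg; have [cg _] := bg; have [M M0 gM] := bcont_bound bg; apply: (conv_approx bg) => e e0.
have e2 : 0 < e / 2 by rewrite divr_gt0.
have [r r0 rP] := uniform_modulus cF cg e2.
(* At distance at least [r] from [u] the quadratic term then exceeds the trivial bound [2 * M]; [N]
   below makes [K / N] at most [e / 2]. *)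
pose K := 2 * M / r ^+ 2.
have r20 : 0 < r ^+ 2 by rewrite exprn_gt0.
have K0 : 0 <= K by rewrite divr_ge0 ?mulr_ge0// ltW.
pose N := (Num.truncn (K / (e / 2))).+1.
have N0 : 0 < N%:R :> R by rewrite ltr0n.
have KN : K / N%:R <= e / 2.
  by rewrite ler_pdivrMr// mulrC -ler_pdivrMr// ltW// truncnS_gt.
(* The Bernstein coefficients: [g] with the first waiting time frozen at the value where
   [exp (- Phi_0)] is [i / N]. *)
pose G i z := g (path_cons (nlog (i%:R / N%:R)) z).
have [bf cf] := conv_bern N 0 (fun i => bcont_cons (i%:R / N%:R) bg).
exists (fun z => u_ z ^+ 0 * bern N (u_ z) (fun i => G i (path_shift false z))),
  (fun=> e); split => //.
- by split => //; exact: bcont_cst.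
- move=> z z0; rewrite expr0 mul1r distrC [e]splitr.
  have u01 : 0 <= u_ z <= 1 by rewrite /u_ dexp_ge0 dexp_le1.
  apply: le_trans (lerD (lexx _) KN).
  apply: bern_approx => // i i_N.
  have i01 : 0 <= (i%:R : R) / N%:R <= 1.
    by rewrite divr_ge0//= ler_pdivrMr// mul1r ler_nat.
  have gz : g z = g (path_cons (nlog (u_ z)) (path_shift false z)).
    by rewrite /u_ nlogK// path_consK.
  have [ir|ir] := ltP `|i%:R / N%:R - u_ z| r.
    rewrite gz; apply: le_trans (ltW (rP _ _ _ i01 ir)) _.
    by rewrite lerDl mulr_ge0// sqr_ge0.
  apply: le_trans (ler_normB _ _) _.
  apply: le_trans (lerD (gM _) (gM _)) _.
  have : 1 <= (i%:R / N%:R - u_ z) ^+ 2 / r ^+ 2.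
    rewrite ler_pdivlMr// mul1r -[leRHS]real_normK ?num_real//.
    by rewrite lerXn2r// ?nnegrE// ltW.
  have -> : K * (i%:R / N%:R - u_ z) ^+ 2 =
     2 * M * ((i%:R / N%:R - u_ z) ^+ 2 / r ^+ 2).
    by rewrite /K; field; rewrite !gt_eqF.
  have M20 : 0 <= 2 * M by rewrite mulr_ge0.
  move=> /(ler_wpM2l M20); lra.
by rewrite (state_cst sJi).
Qed.

End return_to_hitting.

End limits.

(** * The limit law as a normalized positive functional *)

Section exp_iid_state.
Context {R : realType} {F : pseudoMetricType R} {d : measure_display}
  {Omega : measurableType d}.
Variables (P : probability Omega R) (E : nat -> Omega -> R) (Y : nat -> Omega -> F).
Hypotheses (cF : compact [set: F]) (iid : exp_iid_pair P E Y).

Definition exp_iid_expectation (g : path_space R F -> R) : R :=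
  fine (1%:E * \int[P]_w (g (fun k => (E k w)%:E, fun k => Y k w))%:E)%E.

Let Z (w : Omega) : mpath (Y 0%N point) := (fun k => (E k w)%:E, fun k => Y k w).
Let D0 : set Omega := [set w | 0 <= E 0%N w].

Let mD0 : measurable D0.
Proof.
rewrite (_ : D0 = setT `&` E 0%N @^-1` `[0, +oo[).
  by have [mE _ _ _ _] := iid; exact: mE.
by apply/seteqP; split=> w; rewrite /D0 /preimage/= in_itv/= andbT // => -[].
Qed.

Let mZ : measurable_fun D0 Z.
Proof.
have [mE mY _ _ _] := iid; apply: (@measurable_funS _ _ _ _ setT) => //.
apply: measurable_path => // k.
by apply/measurable_EFinP; exact: (mE k).
Qed.

Let null : P (setT `\` D0) = 0%E.
Proof.
rewrite -(exp_iid_ge0 iid); congr (P _); apply/seteqP; split=> w; rewrite /D0/=.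
  by move=> [_ /negP]; rewrite -ltNge.
by move=> w0; split=> //; apply/negP; rewrite -ltNge.
Qed.

Let fin : (P setT < +oo)%E. Proof. by rewrite ltey_eq fin_num_measure. Qed.

Lemma exp_iid_expectationE g : bcont g ->
  (\int[P]_w (g (fun k => (E k w)%:E, fun k => Y k w))%:E =
   (exp_iid_expectation g)%:E)%E.
Proof.
move=> bg; have := @integral_bcont R F _ Omega cF P (Y 0%N point) setT D0 Z
  measurableT mD0 (@subsetT _ _) null fin mZ g bg.
by rewrite /exp_iid_expectation mul1e => ->.
Qed.

Lemma exp_iid_expectation_state : state exp_iid_expectation.
Proof.
apply: (@integral_state R F _ Omega cF P (Y 0%N point) setT D0 Z 1) => //.
by rewrite mul1e; exact: (probability_setT P).
Qed.

Lemma exp_iid_expectation_damp b a g : 0 < a -> bcont g ->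
  exp_iid_expectation (damp b a g) = (1 + a)^-1 * exp_iid_expectation g.
Proof.
move=> a0 bg; have := exp_iid_damped cF iid b a0 bg.
rewrite (exp_iid_expectationE bg) -EFinM => h.
by rewrite {1}/exp_iid_expectation mul1e [X in fine X]h.
Qed.

End exp_iid_state.

Lemma cvg_EFinP {R : realType} (u : nat -> R) (l : R) :
  (u n)%:E @[n --> \oo] --> l%:E <-> u n @[n --> \oo] --> l.
Proof.
split=> [/fine_cvg //|h]; apply: cvg_EFin; last exact: h.
exact: nearW.
Qed.

Theorem mainTheorem8 (R : realType)
  (d : measure_display) (X : measurableType d) (mu : probability X R)
  (T : X -> X)
  (F : pseudoMetricType R)
  (A : nat -> set X) (psi : nat -> X -> F) (tau : nat -> X -> nat) :
  measure_preserving mu T -> ergodic mu T ->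
  hausdorff_space F -> compact [set: F] ->
  (forall l, measurable (A l)) -> (forall l, (0 < mu (A l))%E) ->
  (fun l => mu (A l)) @ \oo --> 0%E ->
  (forall l, borel_meas_on (A l) (psi l)) ->
  (forall l n, measurable (tau l @^-1` [set n])) ->
  (fun l => cond_prob mu (A l)
              [set x | ((((tau l x)%:R : R))%:E < phiA T (A l) x)%E]) @ \oo --> (1 : R) ->
  (exists K : set (set X -> \bar R),
      compact_P mu K /\ forall l, K (push_cond mu T (tau l) (A l))) ->
  forall (d' : measure_display) (Omega : measurableType d')
         (P : probability Omega R) (E : nat -> Omega -> R) (Y : nat -> Omega -> F),
  exp_iid_pair P E Y ->
  ((forall g : ({ptws nat -> \bar R} * {ptws nat -> F})%type -> R, bcont g ->
      (fun l => (\int[mu]_x (g (scaledPhiA mu T (A l) x,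
                               PsiA T (A l) (psi l) x))%:E)%E) @ \oo -->
      (\int[P]_w (g (fun k => (E k w)%:E, fun k => Y k w))%:E)%E)
   <->
   (forall g : ({ptws nat -> \bar R} * {ptws nat -> F})%type -> R, bcont g ->
      (fun l => cond_int mu (A l) (fun x => (g (scaledPhiA mu T (A l) x,
                               PsitA T (A l) (psi l) x))%:E)) @ \oo -->
      (\int[P]_w (g (fun k => (E k w)%:E, fun k => Y k w))%:E)%E)).
Proof.
move=> mpT ergT _ cF mA A0 rare mpsi _ _ _ d' Omega P E Y iid.
pose J l := hitting_state mu T (A l) (psi l).
pose Jt l := return_state mu T (A l) (psi l).
pose Ji := exp_iid_expectation P E Y.
pose m l := fine (mu (A l)).
pose c a l := (expR (a * m l) - 1) / m l.
have m0 l : 0 < m l.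
  by rewrite -lte_fin fineK ?fin_num_measure//; exact: A0.
have sJ l : state (J l) by exact: hitting_state_state.
have sJt l : state (Jt l) by exact: return_state_state.
have sJi : state Ji by exact: exp_iid_expectation_state.
have c_gt0 a l : 0 < a -> 0 < c a l.
  by move=> a0; rewrite divr_gt0// subr_gt0 expR_gt1 mulr_gt0.
have c_cvg a : 0 < a -> c a l @[l --> \oo] --> a.
  by move=> a0; apply: cvg_expR_quotient => //; exact: fine_cvg rare.
have cE a g l : 0 < a -> bcont g ->
    c a l * J l (damp false a g) = Jt l g - Jt l (damp true a g).
  by move=> a0 bg; exact: hitting_return_identity.
have JiE b a g : 0 < a -> bcont g -> Ji (damp b a g) = (1 + a)^-1 * Ji g.
  by move=> a0 bg; exact: exp_iid_expectation_damp.
(* All integrals of bounded continuous functions are finite, so both convergences can be read in the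
   reals. *)
have hitP g : bcont g -> ((fun l => (\int[mu]_x (g (scaledPhiA mu T (A l) x,
      PsiA T (A l) (psi l) x))%:E)%E) @ \oo -->
    (\int[P]_w (g (fun k => (E k w)%:E, fun k => Y k w))%:E)%E) <->
    (J l g @[l --> \oo] --> Ji g).
  move=> bg; rewrite (exp_iid_expectationE cF iid bg).
  under eq_fun => l do rewrite (hitting_stateE mpT ergT (mA l) (A0 l) (mpsi l) cF bg).
  exact: cvg_EFinP.
have retP g : bcont g -> ((fun l => cond_int mu (A l) (fun x =>
      (g (scaledPhiA mu T (A l) x, PsitA T (A l) (psi l) x))%:E)) @ \oo -->
    (\int[P]_w (g (fun k => (E k w)%:E, fun k => Y k w))%:E)%E) <->
    (Jt l g @[l --> \oo] --> Ji g).
  move=> bg; rewrite (exp_iid_expectationE cF iid bg).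
  under eq_fun => l do rewrite (return_stateE mpT ergT (mA l) (A0 l) (mpsi l) cF bg).
  exact: cvg_EFinP.
split=> h g bg.
  apply/(retP _ bg); move: g bg.
  apply: (hitting_to_return sJt sJi c_cvg cE JiE) => g bg.
  by apply/(hitP _ bg); exact: h.
apply/(hitP _ bg); move: g bg.
apply: (return_to_hitting cF sJ sJi c_gt0 c_cvg cE JiE) => g bg.
by apply/(retP _ bg); exact: h.
Qed.
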